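(* Let $n\in\mathbb{N}$. If $G$ is any group commensurable to $H_n$, the $n$th Houghton group, then $G$ has the $R_\infty$ property.
   Context: $\mathbb{N}=\{1,2,\ldots\}$. Let $X_n:=\{1,\ldots,n\}\times\mathbb{N}$. The $n$th Houghton group $H_n$ is the group of all permutations $g$ of $X_n$ for which there exist integers $t_1(g),\ldots,t_n(g)$ such that, for each $i\in\{1,\ldots,n\}$, $(i,m)g=(i,m+t_i(g))$ for all but finitely many $m\in\mathbb{N}$ (so $H_1$ is the group of finitely supported permutations of $X_1$, and in general there is a short exact sequence $1\to \mathrm{FSym}(X_n)\to H_n\to\mathbb{Z}^{n-1}\to 1$, where $\mathrm{FSym}(X_n)$ is the group of finitely supported permutations of $X_n$). A group $G$ is commensurable to a group $H$ if there exist isomorphic groups $N_G\cong N_H$ with $N_G$ a normal finite index subgroup of $G$ and $N_H$ a normal finite index subgroup of $H$. For a group $G$ and $\phi\in\mathrm{Aut}(G)$ (maps written on the right), elements $a,b\in G$ are $\phi$-twisted conjugate if there is $x\in G$ with $(x^{-1})\phi\, a x=b$; the Reidemeister number $R(\phi)$ is the number of $\phi$-twisted conjugacy classes in $G$. $G$ has the $R_\infty$ property if $R(\phi)=\infty$ (infinitely many classes) for every $\phi\in\mathrm{Aut}(G)$. *)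

(* Defs.v *)
From HB Require Import structures.
From mathcomp Require Import all_boot all_order all_algebra.
From mathcomp Require Import boolp classical_sets functions cardinality.
From mathcomp Require Import zify.

Set Implicit Arguments.
Unset Strict Implicit.
Unset Printing Implicit Defensive.

Local Open Scope classical_set_scope.
Local Open Scope group_scope.

(* Permutations of an arbitrary, possibly infinite, type.  Maps act on the
   right, so g * h is "first g, then h", as for {perm T}. *)

Record sym (T : choiceType) :=
  Sym { sym_fun :> T -> T; sym_bijP : `[< bijective sym_fun >] }.

HB.instance Definition _ (T : choiceType) := [isSub for @sym_fun T].
HB.instance Definition _ (T : choiceType) := [Choice of sym T by <:].

Section SymGroup.
Variable T : choiceType.
Implicit Types g h : sym T.

Fact sym_bij g : bijective g.
Proof. exact/asboolP/sym_bijP. Qed.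

Fact sym_id_subproof : `[< bijective (@id T) >].
Proof. by apply/asboolP; exists id. Qed.

Definition sym_one : sym T := Sym sym_id_subproof.

Fact sym_mul_subproof g h : `[< bijective (h \o g) >].
Proof. by apply/asboolP/bij_comp; apply: sym_bij. Qed.

Definition sym_mul g h : sym T := Sym (sym_mul_subproof g h).

Fact sym_inv_exists g : exists f : T -> T, cancel g f /\ cancel f g.
Proof. by case: (sym_bij g) => f gK fK; exists f. Qed.

Definition sym_inv_fun g : T -> T := projT1 (cid (sym_inv_exists g)).

Fact sym_funK g : cancel g (sym_inv_fun g).
Proof. by rewrite /sym_inv_fun; case: cid => f []. Qed.

Fact sym_funVK g : cancel (sym_inv_fun g) g.
Proof. by rewrite /sym_inv_fun; case: cid => f []. Qed.

Fact sym_inv_subproof g : `[< bijective (sym_inv_fun g) >].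
Proof. by apply/asboolP; exists g; [apply: sym_funVK|apply: sym_funK]. Qed.

Definition sym_inv g : sym T := Sym (sym_inv_subproof g).

Fact sym_mulA : associative sym_mul.
Proof. by move=> f g h; apply: val_inj. Qed.

Fact sym_mul1 : left_id sym_one sym_mul.
Proof. by move=> g; apply: val_inj. Qed.

Fact sym_mulr1 : right_id sym_one sym_mul.
Proof. by move=> g; apply: val_inj. Qed.

Fact sym_mulV : left_inverse sym_one sym_inv sym_mul.
Proof. by move=> g; apply/val_inj/funext => x /=; rewrite sym_funVK. Qed.

Fact sym_mulrV : right_inverse sym_one sym_inv sym_mul.
Proof. by move=> g; apply/val_inj/funext => x /=; rewrite sym_funK. Qed.

HB.instance Definition _ := isGroup.Build (sym T)
  sym_mulA sym_mul1 sym_mulr1 sym_mulV sym_mulrV.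

Lemma symME g h x : (g * h) x = h (g x). Proof. by []. Qed.
Lemma symK g : cancel g (g^-1)%g. Proof. exact: sym_funK. Qed.
Lemma symVK g : cancel (g^-1)%g g. Proof. exact: sym_funVK. Qed.

End SymGroup.

(* Rays and their points are numbered from 0: the pair (i, m) stands for the
   point (i + 1, m + 1) of {1, ..., n} x {1, 2, ...}.  Translations along a ray
   are not affected by this relabelling. *)

Definition ray_space (n : nat) : Type := ('I_n * nat)%type.
HB.instance Definition _ n := Choice.on (ray_space n).

Definition translates_at n (g : sym (ray_space n)) (i : 'I_n) (t : int)
    (m : nat) : Prop :=
  (g (i, m)).1 = i /\ ((g (i, m)).2 : int) = (m%:Z + t)%R.

Definition houghton_perm n (g : sym (ray_space n)) : Prop :=
  exists t : 'I_n -> int,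
    forall i, finite_set [set m | ~ translates_at g i (t i) m].

Lemma translates_atE n (g : sym (ray_space n)) i t m :
  translates_at g i t m ->
  exists2 k : nat, g (i, m) = (i, k) & (k : int) = (m%:Z + t)%R.
Proof. by rewrite /translates_at; case: (g _) => j k /= [-> ?]; exists k. Qed.

Lemma finite_nat_setP (A : set nat) :
  finite_set A <-> exists N, forall m, A m -> (m < N)%N.
Proof.
split=> [/finite_seqP [s ->]|[N AN]]; last exact: sub_finite_set (finite_II N).
exists (\max_(x <- s) x).+1 => m /= ms; rewrite ltnS.
exact: (@leq_bigmax_seq _ s xpredT id m).
Qed.

Lemma houghton_permP n (g : sym (ray_space n)) :
  houghton_perm g <-> exists t : 'I_n -> int, forall i, exists N,
    forall m, (N <= m)%N -> translates_at g i (t i) m.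
Proof.
split=> -[t gt]; exists t => i.
  have [N hN] := (finite_nat_setP _).1 (gt i).
  by exists N => m; rewrite leqNgt; apply: contraNP => /hN.
have [N hN] := gt i; apply/finite_nat_setP; exists N => m /= hm.
by rewrite ltnNge; apply/negP => /hN.
Qed.

Definition houghton_pred n (g : sym (ray_space n)) : bool :=
  `[< houghton_perm g >].

Fact houghton_closed n : group_closed (@houghton_pred n).
Proof.
split.
  apply/asboolP/houghton_permP; exists (fun=> 0%R) => i; exists 0%N => m _.
  by split=> //=; rewrite GRing.addr0.
move=> u v /asboolP/houghton_permP [tu hu] /asboolP/houghton_permP [tv hv].
apply/asboolP/houghton_permP; exists (fun i => tu i - tv i)%R => i.
have [Nu {}hu] := hu i; have [Nv {}hv] := hv i.
exists (Nu + Nv + absz (tu i) + absz (tv i))%N => m hm.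
have /hu/translates_atE [k uE kE] : (Nu <= m)%N by lia.
have [l lE] : exists l : nat, (l : int) = (m%:Z + (tu i - tv i))%R.
  by exists (absz (m%:Z + (tu i - tv i))%R); lia.
have /hv/translates_atE [k' vE k'E] : (Nv <= l)%N by lia.
have kk' : k' = k by lia.
by rewrite /translates_at symME uE -kk' -vE symK.
Qed.

Record houghton (n : nat) :=
  Houghton { houghton_val :> sym (ray_space n);
             houghton_valP : houghton_pred houghton_val }.

HB.instance Definition _ n := [isSub for @houghton_val n].
HB.instance Definition _ n := [Choice of houghton n by <:].
HB.instance Definition _ n := SubChoice_isSubGroup.Build
  (sym (ray_space n)) (@houghton_pred n) (houghton n) (houghton_closed n).

Definition normal_subgroup (G : groupType) (N : groupClosed G) : Prop :=
  forall x y : G, x \in N -> x ^ y \in N.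

Definition finite_index (G : groupType) (N : groupClosed G) : Prop :=
  finite_set [set [set x * y | y in [set` N]] | x in [set: G]].

Definition subgroup_isomorphic (G H : groupType)
    (NG : groupClosed G) (NH : groupClosed H) : Prop :=
  exists f : G -> H, set_bij [set` NG] [set` NH] f /\
    {in NG &, {morph f : x y / x * y}}.

Definition commensurable (G H : groupType) : Prop :=
  exists (NG : groupClosed G) (NH : groupClosed H),
    [/\ normal_subgroup NG, finite_index NG,
        normal_subgroup NH, finite_index NH
      & subgroup_isomorphic NG NH].

Definition twisted_conjugate (G : groupType) (phi : G -> G) (a b : G) : Prop :=
  exists x : G, phi (x^-1) * a * x = b.

Definition twisted_class (G : groupType) (phi : G -> G) (a : G) : set G :=
  [set b | twisted_conjugate phi a b].

(* The Reidemeister number of phi is the number of elements of this set. *)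
Definition twisted_classes (G : groupType) (phi : G -> G) : set (set G) :=
  [set twisted_class phi a | a in [set: G]].

Definition R_infty (G : groupType) : Prop :=
  forall phi : {multiplicative G -> G}, bijective phi ->
    infinite_set (twisted_classes phi).

(* Main.v *)
Require Import Defs.
From HB Require Import structures.
From mathcomp Require Import all_boot all_algebra.
From mathcomp Require Import boolp classical_sets functions cardinality fsbigop.
From mathcomp Require Import zify ring.
Import GRing.Theory.

(** Let [X] be the union of the [n] rays, [f : NG -> NH] an isomorphism between
    finite index normal subgroups of [G] and [H_n], and [phi] an automorphism
    of [G].  Suppose that [phi] has finitely many twisted classes.

    Make everything act on [X].  Let [M] be the subgroup of the [x] in [NG]
    with [phi x] in [NG]; it has finite index in [G].  It acts on [X] in two
    ways, by [a = f] and by [b = f \o phi], both times faithfully, inside [H_n],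
    and with every 3-cycle in the image, since a finite index subgroup
    normalised by the 3-cycles contains them all ([cycle3_in_normal]).  As
    3-cycles can be recognised among the finitely supported permutations from
    the orders of a few products ([cycle3_criterion]), and so can the pairs
    of 3-cycles with a common directed edge ([share_edgeP]), the two actions
    are conjugate: there is a permutation [s] of [X] with
    [b m = s^-1 * a m * s] ([embeddings_conjugate]).

    Then [phi (x^-1) * u * x = v] with [u], [v] in [NG] and [x] in [M] says that
    [s * f u] and [s * f v] are conjugate by [a x], an element of [H_n].  A
    pigeonhole argument over the finitely many twisted classes and the finitely
    many cosets of [NG] ([twisted_pigeonhole]) provides such an [x] in [M] for
    two terms of any given sequence in [G].  So it suffices that, for every
    permutation [s] of [X], some sequence of alternating permutations [c_j] is
    such that no two of the [s * c_j] are conjugate under [H_n]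
    ([coset_not_fused]).

    If [s] has finitely many fixed points, choose the [c_j] so that the [s * c_j]
    have more and more fixed points.  If the fixed points are infinite in
    number, they are raw material for cycles: for [k] odd, [c_j] can create [j]
    new [k]-cycles and disturb no other cycle of length at least 2.  The set
    [P_k] of points of exact period [k] under [s] may be infinite, so these
    elements may still be conjugate; but a conjugator [x] then has to displace
    [P_k]: its drift on [P_k], the number of points that it brings into [P_k]
    minus the number that it takes out, is nonzero, whereas its drift on [P_l]
    is zero for the other lengths [l].  The drift is additive in [x] and zero on
    finitely supported permutations, so it is determined by the translation
    vector of [x] in [Z^n].  If this happened for [n + 1] lengths [k], there
    would be [n + 1] linearly independent drift vectors determined additively
    by vectors of [Z^n], which is impossible ([drift_rank]). *)

Set Implicit Arguments.
Unset Strict Implicit.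
Unset Printing Implicit Defensive.

Local Open Scope classical_set_scope.
Local Open Scope group_scope.

(** * Cycles *)

Section Cycles.
Variable T : choiceType.
Implicit Types (g h k : sym T) (s : seq T) (x y z : T).

Lemma sym_ext g h : g =1 h -> g = h.
Proof. by move=> gh; apply/val_inj/funext. Qed.

Lemma sym_inj g : injective g.
Proof. exact: can_inj (symK g). Qed.

Lemma symXE g m x : (g ^+ m) x = iter m g x.
Proof. by elim: m x => // m IH x; rewrite expgSr symME IH. Qed.

Lemma symJE g h x : (g ^ h) (h x) = h (g x).
Proof. by rewrite /conjg !symME symK. Qed.

(** The [undup] makes a permutation out of every sequence, so that
    [cycle_perm] needs no proof argument. *)
Fact cycle_bij s : `[< bijective (next (undup s)) >].
Proof.
apply/asboolP; exists (prev (undup s)) => x.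
- by rewrite prev_next ?undup_uniq.
- by rewrite next_prev ?undup_uniq.
Qed.

Definition cycle_perm s : sym T := Sym (cycle_bij s).

Lemma cycle_permE s x : uniq s -> cycle_perm s x = next s x.
Proof. by move=> us; rewrite /cycle_perm /= undup_id. Qed.

Definition cycle3 x y z := cycle_perm [:: x; y; z].

Lemma cycle3E x y z w : uniq [:: x; y; z] -> cycle3 x y z w =
  if w == x then y else if w == y then z else if w == z then x else w.
Proof.
by move=> u; rewrite cycle_permE //= (eq_sym w x) (eq_sym w y) (eq_sym w z).
Qed.

End Cycles.

(** Case analysis on all equality tests.  The image of a point under a product
    of 3-cycles nests conditionals inside tests; only tests without a
    conditional are split, hence the innermost first. *)
Ltac eq_cases :=
  repeat match goal with |- context [?a == ?b] =>
    lazymatch a with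
    | context [if _ then _ else _] => fail
    | _ => case: (@eqP _ a b) => ? /=
    end
  end; try congruence.

Section Alternating.
Variable T : choiceType.
Implicit Types (g h k : sym T) (s : seq T) (x y z : T).

Lemma uniq3P x y z : reflect [/\ x <> y, x <> z & y <> z] (uniq [:: x; y; z]).
Proof.
rewrite /= !inE negb_or andbT -andbA.
by apply: (iffP and3P) => -[/eqP ? /eqP ? /eqP ?].
Qed.

Lemma uniq4P x y z t : reflect
  [/\ x <> y, x <> z, x <> t, y <> z & y <> t /\ z <> t] (uniq [:: x; y; z; t]).
Proof.
rewrite /= !inE !negb_or andbT -!andbA; apply: (iffP and5P).
- by case=> /eqP ? /eqP ? /eqP ? /eqP ? /andP[/eqP ? /eqP ?].
- by case=> /eqP ? /eqP ? /eqP ? /eqP ? [/eqP ? /eqP ?]; split=> //; apply/andP.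
Qed.

Lemma cycle3_rot x y z : uniq [:: x; y; z] -> cycle3 x y z = cycle3 y z x.
Proof.
move=> u; have u' : uniq [:: y; z; x] by rewrite -(rot_uniq 1) in u.
have [? ? ?] := uniq3P _ _ _ u.
by apply: sym_ext => w; rewrite !cycle3E //; eq_cases.
Qed.

Lemma cycle3V x y z : uniq [:: x; y; z] -> (cycle3 x y z)^-1 = cycle3 y x z.
Proof.
move=> u; have [? ? ?] := uniq3P _ _ _ u.
have u' : uniq [:: y; x; z] by apply/uniq3P; split; congruence.
apply: (mulIg (cycle3 x y z)); rewrite mulVg; apply: sym_ext => w.
by rewrite symME !cycle3E //=; eq_cases.
Qed.

Lemma cycle3J x y z h : uniq [:: x; y; z] ->
  cycle3 x y z ^ h = cycle3 (h x) (h y) (h z).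
Proof.
move=> u; have u' : uniq [:: h x; h y; h z].
  by rewrite -[[:: _; _; _]]/(map h [:: x; y; z]) map_inj_uniq //; apply: sym_inj.
apply: sym_ext => w; rewrite -[w](symVK h) symJE !cycle3E //.
by rewrite !(inj_eq (@sym_inj _ h)); case: ifP => // _; case: ifP => // _; case: ifP.
Qed.

(** A 3-cycle through [x] from two others that share an edge, with an arbitrary
    auxiliary point [v].  This identity serves both to exhibit 3-cycles in a
    finite index subgroup and to generate all 3-cycles from a pencil of
    them. *)
Lemma cycle3VM x v y z : uniq [:: x; v; y; z] ->
  (cycle3 x v y)^-1 * cycle3 x v z = cycle3 x y z.
Proof.
move=> u; have [? ? ? ? [? ?]] := uniq4P _ _ _ _ u.
have u1 : uniq [:: x; v; y] by apply/uniq3P.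
have u2 : uniq [:: v; x; y] by apply/uniq3P; split; congruence.
have u3 : uniq [:: x; v; z] by apply/uniq3P.
have u4 : uniq [:: x; y; z] by apply/uniq3P.
by rewrite cycle3V //; apply: sym_ext => w; rewrite symME !cycle3E //; eq_cases.
Qed.

Definition is_cycle3 g := exists x y z, uniq [:: x; y; z] /\ g = cycle3 x y z.

Inductive alternating : sym T -> Prop :=
| alternating1 : alternating 1
| alternatingM g x y z : uniq [:: x; y; z] -> alternating g ->
    alternating (g * cycle3 x y z).

End Alternating.

(** * Alternating permutations and recognition of 3-cycles *)

Section Recognition.
Variable T : choiceType.
Implicit Types (g h k : sym T) (s : seq T) (x y z : T).

Lemma infinite_set_fresh (F : set T) s :
  infinite_set F -> exists2 w, F w & w \notin s.
Proof.
move=> Finf; apply: contrapT => no; apply: Finf.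
apply: (@sub_finite_set _ _ [set` s]); last exact: finite_seq.
by move=> w Fw /=; apply: contrapT => /negP ws; apply: no; exists w.
Qed.

Lemma infinite_set_fresh_seq (F : set T) s n : infinite_set F ->
  exists r, [/\ size r = n, uniq r & forall w, w \in r -> F w /\ w \notin s].
Proof.
move=> Finf; elim: n => [|n [r [rn ur rF]]]; first by exists [::].
have [w Fw] := infinite_set_fresh (r ++ s) Finf.
rewrite mem_cat negb_or => /andP[wr ws].
exists (w :: r); split=> //=; rewrite ?rn ?wr //.
by move=> v; rewrite inE => /predU1P[->|/rF].
Qed.

Lemma alternating_cycle3 x y z : uniq [:: x; y; z] -> alternating (cycle3 x y z).
Proof. by move=> u; rewrite -[cycle3 _ _ _]mul1g; apply: alternatingM => //; left. Qed.

Lemma alternating_mul g h : alternating g -> alternating h -> alternating (g * h).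
Proof.
move=> ag; elim=> [|{}h x y z u _ IH]; first by rewrite mulg1.
by rewrite mulgA; apply: alternatingM.
Qed.

(** The alternating group of an infinite set is highly transitive: one more
    prescribed value is obtained by a 3-cycle through a fresh point, which is
    there to make the correction even. *)
Lemma alternating_extend (xs ys : seq T) : infinite_set [set: T] ->
  uniq xs -> uniq ys -> size xs = size ys ->
  exists2 h, alternating h & map h xs = ys.
Proof.
move=> Tinf; elim: xs ys => [|x xs IH] [|y ys] //=; first by exists 1 => //; left.
move=> /andP[xxs uxs] /andP[yys uys] [/IH[] // h ah hxs].
have hx : h x \notin ys by rewrite -hxs mem_map //; apply: sym_inj.
have [hxy|hxy] := eqVneq (h x) y; first by exists h => //; rewrite hxy hxs.
have [w _] := infinite_set_fresh [:: h x, y & ys] Tinf.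
rewrite !inE !negb_or => /and3P[wx wy wys].
have u : uniq [:: h x; y; w] by rewrite /= !inE negb_or hxy eq_sym wx eq_sym wy.
exists (h * cycle3 (h x) y w); first exact: alternatingM.
rewrite symME cycle3E // eqxx; congr (_ :: _); rewrite -hxs.
apply/eq_in_map => a axs; rewrite symME cycle3E //.
have : h a \in ys by rewrite -hxs map_f.
case: eqP => [-> /(negP hx)//|_]; case: eqP => [-> /(negP yys)//|_].
by case: eqP => // -> /(negP wys).
Qed.

(** Every orbit lies in [s], so its length divides [(size s)`!]. *)
Lemma expg_fact_support g s : (forall x, g x <> x -> x \in s) ->
  g ^+ (size s)`! = 1.
Proof.
move=> gs; apply: sym_ext => x; rewrite symXE [RHS]/=.
have [gx|/eqP gx] := eqVneq (g x) x; first exact: iter_fix.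
have itS j : iter j g x \in s.
  by apply: gs; elim: j => // j IH /= /sym_inj.
have : looping g x (size s).
  rewrite -[looping _ _ _]negbK -looping_uniq; apply/negP => u.
  have /(uniq_leq_size u) : {subset traject g x (size s).+1 <= s}.
    by move=> _ /trajectP[j _ ->].
  by rewrite size_traject ltnn.
move=> /trajectP[i ltis] /esym; rewrite -{1}(subnK (ltnW ltis)) iterD => e.
have iter_inj j : injective (iter j g) by elim: j => // j IH a b /= /sym_inj /IH.
have {}e : iter (size s - i) g x = x.
  by apply: (iter_inj i); rewrite e -!iterD addnC.
have /dvdnP[q ->] : (size s - i %| (size s)`!)%N by apply: dvdn_fact; lia.
by rewrite iterM; apply: iter_fix.
Qed.

Lemma cycle3_support x y z w : uniq [:: x; y; z] ->
  cycle3 x y z w <> w -> w \in [:: x; y; z].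
Proof. by move=> u; rewrite cycle3E // !inE; eq_cases. Qed.

(** The support has at most 6 points, and 720 is the factorial of 6. *)
Lemma cycle3M_order g h : is_cycle3 g -> is_cycle3 h -> (g * h) ^+ 720 = 1.
Proof.
move=> [x [y [z [u ->]]]] [x' [y' [z' [u' ->]]]].
apply: (@expg_fact_support _ [:: x; y; z; x'; y'; z']) => w.
rewrite symME -[_ :: _]/([:: x; y; z] ++ [:: x'; y'; z']) mem_cat => ne.
apply/orP; have [e|ne1] := pselect (cycle3 x y z w = w).
  by rewrite e in ne; right; apply: (cycle3_support u').
by left; apply: (cycle3_support u ne1).
Qed.

Lemma cycle3_neq1 g : is_cycle3 g -> g <> 1.
Proof.
move=> [x [y [z [u ->]]]] /(congr1 (fun g : sym T => g x)).
by rewrite cycle3E // eqxx /= => e; move: u; rewrite e /= !inE eqxx.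
Qed.

Lemma cycle3_cube g : is_cycle3 g -> g ^+ 3 = 1.
Proof.
move=> [x [y [z [u ->]]]]; apply: sym_ext => w; rewrite symXE !iterS !cycle3E //=.
have [? ? ?] := uniq3P _ _ _ u.
by eq_cases.
Qed.

(** A finitely supported [b] of order 3 that is not a 3-cycle has two 3-cycles
    [(z1 z2 z3)] and [(z4 z5 z6)].  A conjugate of [b] can be arranged to
    contain the 3-cycle [(z3 z4 w1)] with [w1] a fixed point of [b], and to fix
    [z1], [z2], [z5] and [z6].  These three 3-cycles form a tree, so the
    product of [b] and its conjugate has a 7-cycle, and 7 does not divide
    720. *)
Lemma cycle3_criterion (b : sym T) : infinite_set [set: T] ->
  finite_set [set x | b x <> x] -> b ^+ 3 = 1 -> b <> 1 ->
  (forall h, alternating h -> (b * b ^ h) ^+ 720 = 1) -> is_cycle3 b.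
Proof.
move=> Tinf /finite_seqP[s bs] b3 b1 bord.
have sP x : x \notin s -> b x = x.
  move=> xs; apply: contrapT => bx; have : [set x | b x <> x] x by [].
  by rewrite bs /= (negbTE xs).
have b3E x : b (b (b x)) = x by rewrite -[RHS]/((1 : sym T) x) -b3 symXE.
have moved x : b x <> x -> [/\ uniq [:: x; b x; b (b x)], x \in s, b x \in s & b (b x) \in s].
  move=> bx; split.
  - rewrite /= !inE negb_or; apply/and3P; split=> //; last by apply/eqP => /sym_inj /esym.
    apply/andP; split; first by apply/eqP => /esym.
    by apply/eqP => e; apply: bx; rewrite -[RHS]b3E -e.
  - by apply: contrapT => /negP /sP.
  - by apply: contrapT => /negP /sP /sym_inj.
  - by apply: contrapT => /negP /sP /sym_inj /sym_inj.
have [z1 bz1] : exists x, b x <> x.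
  by apply: contrapT => no; apply: b1; apply: sym_ext => x; apply: contrapT => bx; apply: no; exists x.
have [u123 s1 s2 s3] := moved _ bz1.
set z2 := b z1 in u123 s2 s3; set z3 := b z2 in u123 s3.
have bz3 : b z3 = z1 by exact: b3E.
apply: contrapT => nb.
have [z4 bz4 z4n] : exists2 x, b x <> x & x \notin [:: z1; z2; z3].
  apply: contrapT => no; apply: nb; exists z1, z2, z3; split=> //.
  apply: sym_ext => x; rewrite cycle3E //.
  case: eqP => [->//|n1]; case: eqP => [->//|n2]; case: eqP => [->//|n3].
  apply: contrapT => bx; apply: no; exists x => //.
  by rewrite !inE !negb_or; apply/and3P; split; apply/eqP.
have [u456 s4 s5 s6] := moved _ bz4.
set z5 := b z4 in u456 s5 s6; set z6 := b z5 in u456 s6.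
have bz6 : b z6 = z4 by exact: b3E.
(* Four fixed points of b: h will map them to z1, z2, z5 and z6, which are
   therefore fixed by b ^ h; the first is also the image of z3. *)
have [ws [wsz wsu wss]] := infinite_set_fresh_seq s 4 Tinf.
have {}wss w : w \in ws -> w \notin s by case/wss.
case: ws => [|w1 [|w2 [|w5 [|w6 [|]]]]] // in wsz wsu wss.
have w1s : w1 \notin s by apply: wss; rewrite inE eqxx.
have w2s : w2 \notin s by apply: wss; rewrite !inE eqxx ?orbT.
have w5s : w5 \notin s by apply: wss; rewrite !inE eqxx ?orbT.
have w6s : w6 \notin s by apply: wss; rewrite !inE eqxx ?orbT.
have u6 : uniq [:: z1; z2; z3; z4; z5; z6].
  rewrite -[_ :: _]/([:: z1; z2; z3] ++ [:: z4; z5; z6]) cat_uniq u123 u456 andbT.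
  have stable x : x \in [:: z1; z2; z3] -> b x \in [:: z1; z2; z3].
    by rewrite !inE => /or3P[] /eqP->; rewrite -?/z2 -?/z3 ?bz3 eqxx ?orbT.
  apply/hasPn => x; rewrite mem_seq3 => /or3P[] /eqP->; first exact: z4n.
  - by apply: contra z4n => /stable/stable; rewrite bz6.
  - by apply: contra z4n => /stable; rewrite bz6.
have ys : uniq [:: z3; z4; w1; z1; z2; z5; z6].
  have w1n z : z \in s -> w1 == z = false by move=> zs; apply: contraNF w1s => /eqP->.
  move: u6; rewrite /= !inE !negb_or !(eq_sym _ w1) !w1n //.
  move=> /and5P[/and5P[? ? ? ? ?] /and4P[? ? ? ?] /and3P[? ? ?] /andP[? ?]] /andP[? _].
  rewrite ?(eq_sym z3 z1) ?(eq_sym z3 z2) ?(eq_sym z4 z1) ?(eq_sym z4 z2).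
  by do ?[apply/andP; split].
have xs : uniq [:: z1; z2; z3; w1; w2; w5; w6].
  rewrite -[_ :: _]/([:: z1; z2; z3] ++ [:: w1; w2; w5; w6]) cat_uniq u123 wsu andbT.
  apply/hasPn => x /wss; apply: contra.
  by rewrite mem_seq3 => /or3P[] /eqP->.
have [h ah] := alternating_extend Tinf xs ys erefl.
case=> h1 h2 h3 hw1 hw2 hw5 hw6.
have bhE x : (b ^ h) (h x) = h (b x) by exact: symJE.
set u := b * b ^ h.
have c1 : u z1 = z2 by rewrite symME -/z2 -{1}hw2 bhE sP // hw2.
have c2 : u z2 = z4 by rewrite symME -/z3 -h1 bhE -/z2 h2.
have c3 : u z3 = z1 by rewrite symME bz3 -{1}hw1 bhE sP // hw1.
have c4 : u z4 = z5 by rewrite symME -/z5 -{1}hw5 bhE sP // hw5.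
have c5 : u z5 = z6 by rewrite symME -/z6 -{1}hw6 bhE sP // hw6.
have c6 : u z6 = w1 by rewrite symME bz6 -h2 bhE -/z3 h3.
have c7 : u w1 = z3 by rewrite symME (sP _ w1s) -h3 bhE bz3 h1.
have u7 : iter 7 u z1 = z1 by rewrite !iterS [iter 0 _ _]/= c1 c2 c4 c5 c6 c7 c3.
have u720 : iter 720 u z1 = z1 by rewrite -symXE bord.
(* u ^ 7 fixes z1, hence so does u ^ 721, as 721 = 103 * 7. *)
have : u z1 = z1.
  rewrite -{1}u720 -iterS -[721]/(103 * 7)%N iterM.
  exact: iter_fix.
by rewrite c1 => e; move: u123; rewrite e /= !inE eqxx.
Qed.

End Recognition.

(** * Directed edges of 3-cycles *)

Section Edges.
Variable T : choiceType.
Implicit Types (g h k : sym T) (x y z : T).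

Lemma cycle3_moved x y z w : uniq [:: x; y; z] -> w \in [:: x; y; z] ->
  cycle3 x y z w <> w.
Proof.
move=> u; have [? ? ?] := uniq3P _ _ _ u.
by rewrite cycle3E // !inE => /or3P[] /eqP->; eq_cases.
Qed.

Lemma cycle3_at g w : is_cycle3 g -> g w <> w ->
  uniq [:: w; g w; g (g w)] /\ g = cycle3 w (g w) (g (g w)).
Proof.
move=> [x [y [z [u ->]]]] /(cycle3_support u).
have u1 : uniq [:: y; z; x] by rewrite -(rot_uniq 1) in u.
have u2 : uniq [:: z; x; y] by rewrite -(rot_uniq 1) in u1.
have [? ? ?] := uniq3P _ _ _ u.
have ey : cycle3 x y z y = z by rewrite cycle3E //; eq_cases.
have ez : cycle3 x y z z = x by rewrite cycle3E //; eq_cases.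
have ex : cycle3 x y z x = y by rewrite cycle3E //; eq_cases.
rewrite !inE => /or3P[] /eqP->; rewrite ?(ex, ey, ez); split=> //.
- exact: cycle3_rot.
- by rewrite cycle3_rot // cycle3_rot.
Qed.

Lemma cycle3_moved_in g w v : is_cycle3 g -> g w <> w -> g v <> v ->
  v \in [:: w; g w; g (g w)].
Proof. by move=> g3 /(cycle3_at g3)[u ge] gv; apply: (cycle3_support u); rewrite -ge. Qed.

(** A 3-cycle is a triangle with three directed edges.  Two 3-cycles on four
    points either share a directed edge or have an edge in opposite
    directions. *)
Definition share_edge g h :=
  exists q r s t, [/\ uniq [:: q; r; s; t], g = cycle3 q r s & h = cycle3 q r t].

Lemma uniq4_uniq3 (q r s t : T) : uniq [:: q; r; s; t] ->
  [/\ uniq [:: q; r; s], uniq [:: q; r; t] & s != t].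
Proof.
rewrite /= !inE !negb_or => /and4P[/and3P[? ? ?] /andP[? ?] ? _].
by split=> //; do ?[apply/andP; split].
Qed.

(** For 3-cycles [g] and [h], the product [g * h] has order 1 or 3 if they have
    the same support, 5 or 3 if the supports share one point or none, and 3 if
    they share an edge with opposite directions; the remaining case has order 2.
    The converse goes through a point [p] moved by [g] only: following it
    through [g * h * g * h = 1] shows that [h] maps [g p] to [g (g p)]. *)
Lemma share_edgeP g h : is_cycle3 g -> is_cycle3 h ->
  share_edge g h <-> (g * h) ^+ 2 = 1 /\ g * h <> 1.
Proof.
move=> g3 h3; split.
  move=> [q [r [s [t [u -> ->]]]]]; have [us ut _] := uniq4_uniq3 u.
  have [? ? ? ? [? ?]] := uniq4P _ _ _ _ u.
  split; last first.
    move=> /(congr1 (fun g : sym T => g q)); rewrite symME !cycle3E //=; eq_cases.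
  by apply: sym_ext => w; rewrite symXE !iterS !symME !cycle3E //=; eq_cases.
move=> [gh2 gh1].
have gh2E x : h (g (h (g x))) = x by rewrite -[RHS]/((1 : sym T) x) -gh2 symXE.
have [p gp hp] : exists2 p, g p <> p & h p = p.
  apply: contrapT => no; apply: gh1.
  have hm p : g p <> p -> h p <> p by move=> gp hp; apply: no; exists p.
  have [x [y [z [u gE]]]] := g3.
  have mem w : w \in [:: x; y; z] -> h w <> w.
    by move=> wxyz; apply: hm; rewrite gE; apply: cycle3_moved.
  have hx : h x <> x by apply: mem; rewrite inE eqxx.
  have [u' hE] := cycle3_at h3 hx.
  have [xy xz yz] := uniq3P _ _ _ u.
  have : z \in [:: x; h x; h (h x)] by apply: cycle3_moved_in => //; apply: mem; rewrite !inE eqxx ?orbT.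
  have : y \in [:: x; h x; h (h x)] by apply: cycle3_moved_in => //; apply: mem; rewrite !inE eqxx ?orbT.
  rewrite !inE => /or3P[] /eqP ye /or3P[] /eqP ze; try congruence.
    (* h = g, and g ^ 4 = g *)
    have hg : h = g by rewrite gE hE -ze -ye.
    have := gh2; rewrite hg -!expg2 -expgnA -[(2 * 2)%N]/(3 + 1)%N.
    by rewrite expgnDr (cycle3_cube g3) mul1g expg1 => /(cycle3_neq1 g3).
  have -> : h = g^-1.
    have u1 : uniq [:: y; x; z] by apply/uniq3P; split; congruence.
    by rewrite gE cycle3V // hE -ye -ze [RHS]cycle3_rot.
  by rewrite mulgV.
have [u gE] := cycle3_at g3 gp.
set q := g p in u gE; set r := g q in u gE.
have rp : g r = p.
  by rewrite /r /q -[RHS]/((1 : sym T) p) -(cycle3_cube g3) symXE.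
have hq : h q = r.
  by apply: (@sym_inj _ g); apply: (@sym_inj _ h); rewrite rp hp; apply: gh2E.
have hqq : h q <> q.
  by rewrite hq => e; move: u; rewrite e /= !inE eqxx andbF.
have [u' hE] := cycle3_at h3 hqq.
have u1 : uniq [:: q; r; p] by rewrite -(rot_uniq 1) in u.
exists q, r, p, (h r); split; first last.
- by rewrite {1}hE hq.
- by rewrite {1}gE cycle3_rot.
have [qr qp rp'] := uniq3P _ _ _ u1; rewrite hq in u'.
have [_ qhr rhr] := uniq3P _ _ _ u'.
have phr : p <> h r by rewrite -{1}hp => /sym_inj; congruence.
by apply/uniq4P.
Qed.

(** On four points, the faces of a tetrahedron could a priori share edges
    pairwise without a common one, but then two of them would have an edge in
    opposite directions. *)
Lemma share_edge_common e f y0 y1 g : uniq [:: e; f; y0; y1] -> is_cycle3 g ->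
  share_edge g (cycle3 e f y0) -> share_edge g (cycle3 e f y1) ->
  exists2 y, uniq [:: e; f; y] & g = cycle3 e f y.
Proof.
move=> u g3; have [u0 u1 /eqP y01] := uniq4_uniq3 u.
have [ef ey0 ey1 fy0 [fy1 _]] := uniq4P _ _ _ _ u.
suff edge y : uniq [:: e; f; y] -> share_edge g (cycle3 e f y) ->
    [\/ g e = f, g f = y | g y = e].
  have fin : g e = f -> exists2 y, uniq [:: e; f; y] & g = cycle3 e f y.
    move=> gef; have gee : g e <> e by rewrite gef; congruence.
    by have [u' gE] := cycle3_at g3 gee; exists (g f); rewrite -?gef.
  move=> /(edge _ u0)[/fin//|g0|g0] /(edge _ u1)[/fin//|g1|g1].
  - by congruence.
  - have := @cycle3_moved_in g f y1 g3; rewrite g0 !inE g1 => /(_ _ _)/or3P[]; try congruence.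
    + by move/eqP; congruence.
    + by move/eqP; congruence.
    + move=> /eqP e1; have := cycle3_cube g3 => /(congr1 (fun g : sym T => g f)).
      by rewrite symXE !iterS /= g0 -e1 g1 => /esym; congruence.
  - have := @cycle3_moved_in g f y0 g3; rewrite g1 !inE g0 => /(_ _ _)/or3P[]; try congruence.
    + by move/eqP; congruence.
    + by move/eqP; congruence.
    + move=> /eqP e1; have := cycle3_cube g3 => /(congr1 (fun g : sym T => g f)).
      by rewrite symXE !iterS /= g1 -e1 g0 => /esym; congruence.
  - by have : y0 = y1 by apply: (@sym_inj _ g); rewrite g0 g1.
move=> uy [q [r [s [t [uq gE /(congr1 (fun g : sym T => g q))]]]]].
have [us ut st] := uniq4_uniq3 uq.
have gq : g q = r by rewrite gE cycle3E // eqxx.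
have qr : q <> r by move=> qr; move: uq; rewrite qr /= !inE eqxx.
rewrite [RHS]cycle3E // eqxx cycle3E //.
case: eqP => [qe fr|_]; first by constructor 1; congruence.
case: eqP => [qe fr|_]; first by constructor 2; congruence.
case: eqP => [qe fr|_]; first by constructor 3; congruence.
by move=> /qr.
Qed.

Lemma cycle3_commutant k : infinite_set [set: T] ->
  (forall c, is_cycle3 c -> k * c = c * k) -> k = 1.
Proof.
move=> Tinf kc; apply: sym_ext => z; apply: contrapT => /= /eqP kz.
have [r [rsz ru rs]] := infinite_set_fresh_seq [:: z; k z] 2 Tinf.
case: r => [|v [|w []]] // in rsz ru rs.
have [_] := rs v (mem_head _ _); rewrite !inE negb_or => /andP[vz vkz].
have [|_] := rs w; first by rewrite !inE eqxx orbT.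
rewrite !inE negb_or => /andP[wz wkz].
have u : uniq [:: z; v; w].
  by apply/andP; split; rewrite // !inE negb_or ![z == _]eq_sym vz wz.
have /kc/(congr1 (fun g : sym T => g z)) : is_cycle3 (cycle3 z v w).
  by exists z, v, w.
rewrite !symME !cycle3E // eqxx (negbTE kz) ![k z == _]eq_sym (negbTE vkz) (negbTE wkz).
by move=> /sym_inj e; rewrite e eqxx in vz.
Qed.

(** Stated for a property [E] that behaves as a subgroup on 3-cycles only,
    which is how it is available for the property of being mapped by one
    embedding to a given conjugate of its image by another. *)
Lemma cycle3_gen (E : sym T -> Prop) a b : a != b ->
  (forall x, uniq [:: a; b; x] -> E (cycle3 a b x)) ->
  (forall g, is_cycle3 g -> E g -> E g^-1) ->
  (forall g h, is_cycle3 g -> is_cycle3 h -> E g -> E h -> E (g^-1 * h)) ->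
  forall g, is_cycle3 g -> E g.
Proof.
move=> /eqP ab Eab EV EVM.
(* 3-cycles through a *)
have Ea y z : uniq [:: a; y; z] -> E (cycle3 a y z).
  move=> u; have [ay az yz] := uniq3P _ _ _ u.
  have Eb x : x <> a -> x <> b -> is_cycle3 (cycle3 a b x) /\ E (cycle3 a b x).
    move=> xa xb; have ux : uniq [:: a; b; x] by apply/uniq3P; split; congruence.
    by split; [exists a, b, x | apply: Eab].
  have [yb|/eqP yb] := eqVneq y b; first by rewrite yb in u *; apply: Eab.
  have [yC yE] := Eb y (nesym ay) yb.
  have [zb|/eqP zb] := eqVneq z b.
    have -> : cycle3 a y z = (cycle3 a b y)^-1; last exact: EV.
    rewrite zb cycle3V; last by apply/uniq3P; split; congruence.
    by rewrite [RHS]cycle3_rot //; apply/uniq3P; split; congruence.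
  have [zC zE] := Eb z (nesym az) zb.
  rewrite -(@cycle3VM _ a b); first exact: EVM.
  by apply/uniq4P; do !split; congruence.
have Eta x y : uniq [:: x; a; y] -> is_cycle3 (cycle3 x a y) /\ E (cycle3 x a y).
  move=> u; split; first by exists x, a, y.
  by rewrite cycle3_rot //; apply: Ea; rewrite -(rot_uniq 1) in u.
move=> g [x [y [z [u ->]]]]; have [xy xz yz] := uniq3P _ _ _ u.
have [xa|/eqP xa] := eqVneq x a; first by rewrite xa in u *; apply: Ea.
have [ya|/eqP ya] := eqVneq y a; first by rewrite ya in u *; apply: (Eta _ _ _).2.
have [za|/eqP za] := eqVneq z a.
  have ua : uniq [:: a; x; y] by apply/uniq3P; split; congruence.
  by rewrite za -cycle3_rot //; apply: Ea.
have [|yC yE] := Eta x y; first by apply/uniq3P; split; congruence.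
have [|zC zE] := Eta x z; first by apply/uniq3P; split; congruence.
rewrite -(@cycle3VM _ x a); first exact: EVM.
by apply/uniq4P; do !split; congruence.
Qed.

End Edges.

(** * Subgroups that contain all 3-cycles *)

Lemma infinite_set_injection (T : choiceType) (F : set T) (s : seq T) :
  infinite_set F -> exists u : nat -> T, injective u /\ forall j, F (u j) /\ u j \notin s.
Proof.
move=> Finf; have /choice[fresh freshP] r : exists w, F w /\ w \notin r ++ s.
  by have [w] := infinite_set_fresh (r ++ s) Finf; exists w.
pose r j := iter j (fun r => fresh r :: r) [::].
exists (fun j => fresh (r j)); split; last first.
  by move=> j; have [Fj] := freshP (r j); rewrite mem_cat negb_or => /andP[].
have lt_neq i j : i < j -> fresh (r i) != fresh (r j).
  move=> ij; have ri : fresh (r i) \in r j.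
    elim: j ij => // j IH; rewrite ltnS leq_eqVlt => /predU1P[->|/IH ri].
      exact: mem_head.
    by rewrite inE ri orbT.
  have [_] := freshP (r j); rewrite mem_cat negb_or => /andP[+ _].
  by apply: contraNneq => <-.
by move=> i j /eqP; case: (ltngtP i j) => // /lt_neq; rewrite 1?eq_sym => /negP.
Qed.

(** Among the 3-cycles [(u v y)] with [y] variable, two lie in the same coset of
    [K], so that [K] contains a 3-cycle [(u y y')]; conjugation by two 3-cycles
    then turns [y] into [v] and [y'] into [w]. *)
Lemma cycle3_in_normal (T : choiceType) (K : sym T -> Prop) :
  infinite_set [set: T] ->
  (forall k c, is_cycle3 c -> K k -> K (k ^ c)) ->
  (forall u : nat -> sym T, (forall j, is_cycle3 (u j)) ->
     exists i j, i <> j /\ K ((u i)^-1 * u j)) ->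
  forall c, is_cycle3 c -> K c.
Proof.
move=> Tinf KJ Kfin _ [u [v [w [uvw ->]]]].
have [y [y_inj yuvw]] := infinite_set_injection [:: u; v; w] Tinf.
have [uv uw vw] := uniq3P _ _ _ uvw.
have yP j : [/\ y j <> u, y j <> v & y j <> w].
  by have [_] := yuvw j; rewrite !inE !negb_or => /and3P[/eqP ? /eqP ? /eqP ?].
have [i [j [ij]]] : exists i j, i <> j /\ K ((cycle3 u v (y i))^-1 * cycle3 u v (y j)).
  apply: Kfin => j; exists u, v, (y j); split=> //.
  by have [? ? ?] := yP j; apply/uniq3P; split; congruence.
have [? ? ?] := yP i; have [? ? ?] := yP j.
have yij : y i <> y j by move=> /y_inj.
rewrite cycle3VM; last by apply/uniq4P; do !split; congruence.
have u1 : uniq [:: u; y i; y j] by apply/uniq3P; split; congruence.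
have u2 : uniq [:: y i; v; w] by apply/uniq3P; split; congruence.
have u3 : uniq [:: y j; w; y i] by apply/uniq3P; split; congruence.
have u4 : uniq [:: u; v; y j] by apply/uniq3P; split; congruence.
move=> /(KJ _ (cycle3 (y i) v w)); rewrite cycle3J //.
have -> : cycle3 (y i) v w u = u by rewrite cycle3E //; eq_cases.
have -> : cycle3 (y i) v w (y i) = v by rewrite cycle3E //; eq_cases.
have -> : cycle3 (y i) v w (y j) = y j by rewrite cycle3E //; eq_cases.
move=> /(_ (ex_intro _ _ (ex_intro _ _ (ex_intro _ _ (conj u2 erefl))))).
move=> /(KJ _ (cycle3 (y j) w (y i))); rewrite cycle3J //.
have -> : cycle3 (y j) w (y i) u = u by rewrite cycle3E //; eq_cases.
have -> : cycle3 (y j) w (y i) v = v by rewrite cycle3E //; eq_cases.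
have -> : cycle3 (y j) w (y i) (y j) = w by rewrite cycle3E //; eq_cases.
by apply; exists (y j), w, (y i).
Qed.

(** * Two embeddings with all 3-cycles are conjugate *)

Section Embeddings.
Variables (T : choiceType) (P : groupType).
Hypothesis Tinf : infinite_set [set: T].

(** What the two actions of a subgroup of a group commensurable to a Houghton
    group have in common.  The last condition excludes images of order 3 with
    infinite support, to which the recognition of 3-cycles does not apply; in a
    Houghton group it holds because the quotient by the finitely supported
    permutations is torsion free. *)
Record alt_embedding (a : P -> sym T) : Prop := AltEmbedding {
  alt_embM : {morph a : p q / p * q};
  alt_emb_inj : injective a;
  alt_emb_cycle3 : forall c, is_cycle3 c -> exists p, a p = c;
  alt_emb_finite : forall p, p ^+ 3 = 1 -> finite_set [set x | a p x <> x] }.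

Section Theory.
Variables (a : P -> sym T) (aP : alt_embedding a).

Lemma alt_emb1 : a 1 = 1.
Proof. by apply: (mulIg (a 1)); rewrite -alt_embM // !mul1g. Qed.

Lemma alt_embX p m : a (p ^+ m) = a p ^+ m.
Proof.
by elim: m => [|m IH]; rewrite ?expg0 ?alt_emb1 // !expgS alt_embM // IH.
Qed.

Lemma alt_embV p : a p^-1 = (a p)^-1.
Proof. by apply: (mulIg (a p)); rewrite -alt_embM // !mulVg alt_emb1. Qed.

Lemma alt_embJ p q : a (p ^ q) = a p ^ a q.
Proof. by rewrite /conjg !alt_embM // alt_embV. Qed.

Lemma alt_emb_eq1 p : a p = 1 -> p = 1.
Proof. by rewrite -alt_emb1 => /alt_emb_inj; apply. Qed.

Lemma alt_emb_alternating h : alternating h -> exists p, a p = h.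
Proof.
elim=> [|_ x y z u _ [p <-]]; first by exists 1; rewrite alt_emb1.
have [|q qE] := alt_emb_cycle3 aP (c := cycle3 x y z); first by exists x, y, z.
by exists (p * q); rewrite alt_embM // qE.
Qed.

End Theory.

Lemma is_cycle3J (c h : sym T) : is_cycle3 c -> is_cycle3 (c ^ h).
Proof.
move=> [x [y [z [u ->]]]]; exists (h x), (h y), (h z); split; last exact: cycle3J.
by rewrite -[[:: _; _; _]]/(map h [:: x; y; z]) map_inj_uniq //; apply: sym_inj.
Qed.

(** The criterion for being a 3-cycle only involves orders of elements and
    conjugation by alternating permutations, and it passes through [P] from one
    embedding to the other. *)
Lemma embedding_is_cycle3 a b p : alt_embedding a -> alt_embedding b ->
  is_cycle3 (a p) -> is_cycle3 (b p).
Proof.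
move=> aP bP ap3; have p3 : p ^+ 3 = 1.
  by apply: (alt_emb_eq1 aP); rewrite alt_embX // cycle3_cube.
apply: cycle3_criterion => //.
- exact: alt_emb_finite.
- by rewrite -alt_embX // p3 alt_emb1.
- by move=> /(alt_emb_eq1 bP) p1; apply: (cycle3_neq1 ap3); rewrite p1 alt_emb1.
move=> _ /(alt_emb_alternating bP)[q <-]; rewrite -alt_embJ // -alt_embM // -alt_embX //.
rewrite (_ : _ ^+ _ = 1) ?alt_emb1 //; apply: (alt_emb_eq1 aP).
rewrite alt_embX // alt_embM // alt_embJ //.
by apply: cycle3M_order => //; apply: is_cycle3J.
Qed.

Lemma embedding_share_edge a b p q : alt_embedding a -> alt_embedding b ->
  is_cycle3 (a p) -> is_cycle3 (a q) ->
  share_edge (a p) (a q) -> share_edge (b p) (b q).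
Proof.
move=> aP bP ap aq /(share_edgeP ap aq)[apq2 apq1].
apply/share_edgeP; [exact: embedding_is_cycle3 ap|exact: embedding_is_cycle3 aq|].
split.
  rewrite -alt_embM // -alt_embX // (_ : _ ^+ 2 = 1) ?alt_emb1 //.
  by apply: (alt_emb_eq1 aP); rewrite alt_embX // alt_embM.
by rewrite -alt_embM // => /(alt_emb_eq1 bP) pq1; apply: apq1; rewrite -alt_embM // pq1 alt_emb1.
Qed.

Lemma share_edge_cycle3 (x y z t : T) : uniq [:: x; y; z; t] ->
  share_edge (cycle3 x y z) (cycle3 x y t).
Proof. by move=> u; exists x, y, z, t. Qed.

Lemma is_cycle3_cycle3 (x y z : T) : uniq [:: x; y; z] -> is_cycle3 (cycle3 x y z).
Proof. by move=> u; exists x, y, z. Qed.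

Lemma two_more_points (o1 o2 : T) : exists x0 x1,
  [/\ x0 <> o1 /\ x0 <> o2, x1 <> o1 /\ x1 <> o2 & x0 <> x1].
Proof.
have [r [rsz ru rs]] := infinite_set_fresh_seq [:: o1; o2] 2 Tinf.
case: r => [|x0 [|x1 []]] // in rsz ru rs.
have [_] := rs x0 (mem_head _ _); rewrite !inE negb_or => /andP[/eqP x01 /eqP x02].
have [|_] := rs x1; first by rewrite !inE eqxx orbT.
rewrite !inE negb_or => /andP[/eqP x11 /eqP x12].
have x0x1 : x0 <> x1 by move=> e; rewrite e /= inE eqxx in ru.
by exists x0, x1.
Qed.

(** The 3-cycles through the directed edge from [o1] to [o2] correspond to the
    remaining points [x]; an embedding that preserves shared edges sends this
    pencil into the pencil of an edge from [e] to [f]. *)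
Definition pencil_map (a b : P -> sym T) (o1 o2 e f : T) :=
  forall p x, uniq [:: o1; o2; x] -> a p = cycle3 o1 o2 x ->
    exists2 y, uniq [:: e; f; y] & b p = cycle3 e f y.

Lemma embedding_pencil a b (o1 o2 : T) : alt_embedding a -> alt_embedding b ->
  o1 <> o2 -> exists e f, e <> f /\ pencil_map a b o1 o2 e f.
Proof.
move=> aP bP o12.
have [x0 [x1 [[x01 x02] [x11 x12] x0x1]]] := two_more_points o1 o2.
have U x : x <> o1 -> x <> o2 -> uniq [:: o1; o2; x].
  by move=> ? ?; apply/uniq3P; split; congruence.
have [p0 p0E] := alt_emb_cycle3 aP (is_cycle3_cycle3 (U x0 x01 x02)).
have [p1 p1E] := alt_emb_cycle3 aP (is_cycle3_cycle3 (U x1 x11 x12)).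
have p0c : is_cycle3 (a p0) by rewrite p0E; apply/is_cycle3_cycle3/U.
have p1c : is_cycle3 (a p1) by rewrite p1E; apply/is_cycle3_cycle3/U.
have : share_edge (b p0) (b p1).
  apply: (embedding_share_edge aP bP) => //; rewrite p0E p1E.
  by apply: share_edge_cycle3; apply/uniq4P; do !split; congruence.
move=> [e [f [y0 [y1 [u e0 e1]]]]]; have [u0 u1 _] := uniq4_uniq3 u.
exists e, f; split; first by have [] := uniq3P _ _ _ u0.
move=> p x ux pE.
have [xx0|xx0] := pselect (x = x0).
  have -> : p = p0 by apply: (alt_emb_inj aP); rewrite pE xx0.
  by exists y0.
have [xx1|xx1] := pselect (x = x1).
  have -> : p = p1 by apply: (alt_emb_inj aP); rewrite pE xx1.
  by exists y1.
have [_ ? ?] := uniq3P _ _ _ ux.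
have pc : is_cycle3 (a p) by rewrite pE; apply: is_cycle3_cycle3.
apply: (share_edge_common u); first exact: embedding_is_cycle3 pc.
- rewrite -e0; apply: (embedding_share_edge aP bP) => //; rewrite pE p0E.
  by apply: share_edge_cycle3; apply/uniq4P; do !split; congruence.
- rewrite -e1; apply: (embedding_share_edge aP bP) => //; rewrite pE p1E.
  by apply: share_edge_cycle3; apply/uniq4P; do !split; congruence.
Qed.

(** The edge that [embedding_pencil] finds on the way back must be the initial
    one, as the only edge shared by two 3-cycles of the initial pencil. *)
Lemma pencil_mapV a b (o1 o2 e f : T) : alt_embedding a -> alt_embedding b ->
  o1 <> o2 -> e <> f -> pencil_map a b o1 o2 e f -> pencil_map b a e f o1 o2.
Proof.
move=> aP bP o12 ef ab; have [e' [f' [ef' ba]]] := embedding_pencil bP aP ef.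
suff [<- <-] : e' = o1 /\ f' = o2 by [].
have edge x : x <> o1 -> x <> o2 ->
    uniq [:: o1; o2; x] /\ cycle3 o1 o2 x e' = f'.
  move=> x1 x2; have u : uniq [:: o1; o2; x] by apply/uniq3P; split; congruence.
  split=> //; have [p pE] := alt_emb_cycle3 aP (is_cycle3_cycle3 u).
  have [y uy /(ba _ _ uy)[z uz]] := ab _ _ u pE.
  by rewrite pE => ->; rewrite cycle3E // eqxx.
have [x0 [x1 [[x01 x02] [x11 x12] x0x1]]] := two_more_points o1 o2.
have [u0] := edge _ x01 x02; have [u1] := edge _ x11 x12.
rewrite !cycle3E //; eq_cases.
by split; congruence.
Qed.

(** The conjugating permutation sends [o1] to [e], [o2] to [f], and [x] to the
    third point of the image of the 3-cycle [(o1 o2 x)]; the pencil map in the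
    other direction provides its inverse.  By construction it conjugates [a]
    to [b] on a pencil, hence on all 3-cycles.  For other [p], the permutations
    [b p] and [a p ^ s] conjugate every 3-cycle in the same way, and only the
    identity commutes with all 3-cycles. *)
Theorem embeddings_conjugate a b : alt_embedding a -> alt_embedding b ->
  exists s : sym T, forall p, b p = a p ^ s.
Proof.
move=> aP bP.
have [o1 _ _] := infinite_set_fresh [::] Tinf.
have [o2 [_ [[/nesym o12 _] _ _]]] := two_more_points o1 o1.
have [e [f [ef ab]]] := embedding_pencil aP bP o12.
have ba := pencil_mapV aP bP o12 ef ab.
(* Both directions are treated at once. *)
have rel a' b' q1 q2 e' f' : alt_embedding a' -> q1 <> q2 -> pencil_map a' b' q1 q2 e' f' ->
  exists s : T -> T, [/\ s q1 = e', s q2 = f' & forall p x, uniq [:: q1; q2; x] ->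
    a' p = cycle3 q1 q2 x -> uniq [:: e'; f'; s x] /\ b' p = cycle3 e' f' (s x)].
  move=> aP' q12 ab'; have /choice[s sP] x : exists y, [/\ x = q1 -> y = e', x = q2 -> y = f' &
      forall p, uniq [:: q1; q2; x] ->
      a' p = cycle3 q1 q2 x -> uniq [:: e'; f'; y] /\ b' p = cycle3 e' f' y].
    have [xq1|xq1] := pselect (x = q1).
      exists e'; split=> // [|p /uniq3P[]]; congruence.
    have [xq2|xq2] := pselect (x = q2).
      exists f'; split=> // p /uniq3P[]; congruence.
    have u : uniq [:: q1; q2; x] by apply/uniq3P; split; congruence.
    have [p pE] := alt_emb_cycle3 aP' (is_cycle3_cycle3 u).
    have [y uy bE] := ab' _ _ u pE; exists y; split=> // p' _ p'E.
    by have -> : p' = p by apply: (alt_emb_inj aP'); rewrite pE.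
  exists s; split; first by have [/(_ erefl)] := sP q1.
    by have [_ /(_ erefl)] := sP q2.
  by move=> p x; have [_ _] := sP x; apply.
have [s [s1 s2 sP]] := rel _ _ _ _ _ _ aP o12 ab.
have [s' [s1' s2' sP']] := rel _ _ _ _ _ _ bP ef ba.
have can a' b' q1 q2 e' f' (t t' : T -> T) : alt_embedding a' -> q1 <> q2 ->
    t q1 = e' -> t q2 = f' -> t' e' = q1 -> t' f' = q2 ->
    (forall p x, uniq [:: q1; q2; x] ->
      a' p = cycle3 q1 q2 x -> uniq [:: e'; f'; t x] /\ b' p = cycle3 e' f' (t x)) ->
    (forall p x, uniq [:: e'; f'; x] ->
      b' p = cycle3 e' f' x -> uniq [:: q1; q2; t' x] /\ a' p = cycle3 q1 q2 (t' x)) ->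
    cancel t t'.
  move=> aP' q12 t1 t2 t1' t2' tP tP' x.
  have [->|xq1] := pselect (x = q1); first by rewrite t1.
  have [->|xq2] := pselect (x = q2); first by rewrite t2.
  have u : uniq [:: q1; q2; x] by apply/uniq3P; split; congruence.
  have [p pE] := alt_emb_cycle3 aP' (is_cycle3_cycle3 u).
  have [u' /(tP' _ _ u')[u'']] := tP _ _ u pE.
  rewrite pE => /(congr1 (fun g : sym T => g q2)); rewrite !cycle3E //; eq_cases.
have sB : `[< bijective s >].
  by apply/asboolP; exists s'; [apply: can sP sP' | apply: can sP' sP].
pose sg : sym T := Sym sB.
have main c : is_cycle3 c -> forall p, a p = c -> b p = c ^ sg.
  move: c; apply: (@cycle3_gen _ (fun c => forall p, a p = c -> b p = c ^ sg) o1 o2).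
  - exact/eqP.
  - move=> x u p pE; rewrite cycle3J //.
    by have [_ ->] := sP _ _ u pE; rewrite -s1 -s2.
  - move=> g _ gE p pE; rewrite conjVg -(gE p^-1).
      by rewrite (alt_embV bP) invgK.
    by rewrite (alt_embV aP) pE invgK.
  - move=> g h /(alt_emb_cycle3 aP)[q qE] /(alt_emb_cycle3 aP)[r rE] gE hE p pE.
    have -> : p = q^-1 * r.
      by apply: (alt_emb_inj aP); rewrite (alt_embM aP) (alt_embV aP) qE rE.
    by rewrite (alt_embM bP) (alt_embV bP) (gE _ qE) (hE _ rE) conjMg conjVg.
exists sg => p; apply/esym/divg1_eq; apply: cycle3_commutant => // c c3.
have [q qE] : exists q, b q = c by apply: (alt_emb_cycle3 bP).
have aq3 : is_cycle3 (a q) by apply: (embedding_is_cycle3 bP aP); rewrite qE.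
have Eq : c = a q ^ sg by rewrite -qE; apply: main.
have Eqp : b (q ^ p) = a (q ^ p) ^ sg.
  by apply: main => //; rewrite (alt_embJ aP); apply: is_cycle3J.
move: Eqp; rewrite (alt_embJ bP) (alt_embJ aP) conjJg -Eq qE.
move=> /(congr1 (fun g => g ^ (b p)^-1)); rewrite conjgK => ce.
by rewrite [RHS]conjgC conjgM -ce.
Qed.

End Embeddings.

(** * Translation vectors *)

Section Translations.
Variable n : nat.
Implicit Types (g h : sym (ray_space n)) (t u : 'rV[int]_n).

Definition translation_vector g t :=
  forall i, exists N, forall m, (N <= m)%N -> translates_at g i (t ord0 i) m.

Lemma houghton_translation g : houghton_perm g -> exists t, translation_vector g t.
Proof.
move=> /houghton_permP[t gt]; exists (\row_i t i)%R => i.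
by have [N gN] := gt i; exists N => m /gN; rewrite mxE.
Qed.

Lemma translation_vector1 : translation_vector 1 0%R.
Proof. by move=> i; exists 0%N => m _; rewrite /translates_at mxE /= GRing.addr0. Qed.

Lemma translation_vectorM g h t u : translation_vector g t ->
  translation_vector h u -> translation_vector (g * h) (t + u)%R.
Proof.
move=> gt hu i; have [Ng gN] := gt i; have [Nh hN] := hu i.
exists (Ng + Nh + absz (t ord0 i))%N => m mN.
have /gN/translates_atE[k gE kE] : (Ng <= m)%N by lia.
have /hN/translates_atE[l hE lE] : (Nh <= k)%N by lia.
by rewrite /translates_at symME gE hE mxE /=; split=> //; lia.
Qed.

Lemma translation_vectorV g t : translation_vector g t ->
  translation_vector g^-1 (- t)%R.
Proof.
move=> gt i; have [N gN] := gt i.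
exists (N + absz (t ord0 i))%N => m mN.
have [l lE] : exists l : nat, (l : int) = (m%:Z - t ord0 i)%R.
  by exists (absz (m%:Z - t ord0 i)%R); lia.
have /gN/translates_atE[k gE kE] : (N <= l)%N by lia.
have km : k = m by lia.
by rewrite /translates_at mxE -km -gE symK /=; split=> //; lia.
Qed.

Lemma translation_vector_inj g t u :
  translation_vector g t -> translation_vector g u -> t = u.
Proof.
move=> gt gu; apply/rowP => i; have [N gN] := gt i; have [M gM] := gu i.
have [|_ e] := gN (N + M)%N; first by lia.
by have [|_] := gM (N + M)%N; [lia | rewrite e => /addrI].
Qed.

(** In other words, the kernel of the map to [Z^n] consists of the finitely
    supported permutations. *)
Lemma translation_vector0_finite g : translation_vector g 0%R ->
  finite_set [set z | g z <> z].
Proof.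
move=> g0; have /choice[N gN] i : exists N, forall m, (N <= m)%N -> g (i, m) = (i, m).
  have [N gN] := g0 i; exists N => m /gN/translates_atE[k ->].
  by rewrite mxE GRing.addr0 => -[->].
apply: (@sub_finite_set _ _ ([set: 'I_n] `*` `I_(\max_i N i))); last first.
  by apply: finite_setX; [exact: finite_finset | exact: finite_II].
move=> [i m] /= gim; split=> //=; rewrite ltnNge; apply/negP => Nm.
apply: gim; apply: gN; apply: leq_trans Nm; exact: leq_bigmax.
Qed.

Lemma translation_vectorX g t m : translation_vector g t ->
  translation_vector (g ^+ m) (t *+ m)%R.
Proof.
move=> gt; elim: m => [|m IH]; first exact: translation_vector1.
by rewrite expgS mulrS; apply: translation_vectorM.
Qed.

Lemma houghton_torsion_finite g : houghton_perm g -> g ^+ 3 = 1 ->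
  finite_set [set z | g z <> z].
Proof.
move=> /houghton_translation[t gt] g3; apply: translation_vector0_finite.
suff <- : t = 0%R by [].
have := translation_vectorX 3 gt; rewrite g3 => /(translation_vector_inj translation_vector1) e.
apply/rowP => i; have /rowP/(_ i) := e; rewrite mulmxnE !mxE => /esym/eqP.
by rewrite -mulr_natr mulf_eq0 orbF => /eqP.
Qed.

Lemma cycle3_houghton g : is_cycle3 g -> houghton_perm g.
Proof.
move=> [x [y [z [u ->]]]]; apply/houghton_permP; exists (fun=> 0%R) => i.
exists (x.2 + y.2 + z.2).+1 => m mN; rewrite /translates_at GRing.addr0.
have -> : cycle3 x y z (i, m) = (i, m); last by [].
apply: contrapT => /(cycle3_support u); rewrite !inE.
by move=> /or3P[] /eqP e; move: mN; rewrite -e /=; lia.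
Qed.

End Translations.

(** * Drift of a permutation across a function *)

Section Drift.
Variable T : choiceType.
Implicit Types (x y : sym T) (w : T -> int).

(** For the indicator function [w] of a set [A], the drift of [x] is the number
    of points that [x] brings into [A] minus the number of points that it takes
    out of [A]. *)
Definition almost_invariant w x := finite_set [set z | w (x z) <> w z].

Definition drift w x : int := (\sum_(z \in [set: T]) (w (x z) - w z))%R.

Lemma drift_seq w x (s : seq T) : uniq s -> (forall z, z \notin s -> w (x z) = w z) ->
  drift w x = (\sum_(z <- s) (w (x z) - w z))%R.
Proof.
move=> us ws; rewrite [RHS]fsbig_seq //; apply/esym/fsbig_widen => // z [_ /negP /ws] /= ->.
exact: subrr.
Qed.

Lemma almost_invariantP w x : almost_invariant w x ->
  exists s : seq T, forall z, z \notin s -> w (x z) = w z.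
Proof.
move=> /finite_seqP[s sE]; exists s => z zs; apply: contrapT => wz.
by move: zs; have : [set z | w (x z) <> w z] z by []; rewrite sE /= => ->.
Qed.

(** The summand for [x * y] is the summand for [y] at [x z] plus the summand for
    [x] at [z], and [x] is a bijection. *)
Lemma driftM w x y : almost_invariant w x -> almost_invariant w y ->
  almost_invariant w (x * y) /\ drift w (x * y) = (drift w x + drift w y)%R.
Proof.
move=> wx wy; have [s sP] := almost_invariantP wx; have [r rP] := almost_invariantP wy.
pose q := undup (s ++ map (x^-1)%g r); have uq : uniq q by exact: undup_uniq.
have qs z : z \notin q -> z \notin s by rewrite mem_undup mem_cat negb_or => /andP[].
have qr z : z \notin q -> x z \notin r.
  rewrite mem_undup mem_cat negb_or => /andP[_]; apply: contra => xr.
  by rewrite -[z](symK x) map_f.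
have qxr z : z \notin map x q -> z \notin r.
  apply: contra => zr; rewrite -[z](symVK x) map_f //.
  by rewrite mem_undup mem_cat map_f // orbT.
have qE z : z \notin q -> w ((x * y) z) = w z.
  by move=> zq; rewrite symME rP ?qr // sP // qs.
split.
  apply: (@sub_finite_set _ _ [set` q]); last exact: finite_seq.
  by move=> z /= wz; apply: contrapT => /negP /qE.
have uxq : uniq (map x q) by rewrite map_inj_uniq //; apply: sym_inj.
rewrite (drift_seq uq qE) (drift_seq (x := x) uq); last by move=> z /qs /sP.
rewrite (drift_seq (x := y) uxq); last by move=> z /qxr /rP.
rewrite big_map -big_split /=; apply: eq_bigr => z _.
by rewrite addrC subrKA.
Qed.

Lemma drift_finite w x : finite_set [set z | x z <> z] ->
  almost_invariant w x /\ drift w x = 0%R.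
Proof.
move=> xfin; split; first by apply: sub_finite_set xfin => z /= wz xz; apply: wz; rewrite xz.
have [s sE] := (finite_seqP _).1 xfin.
have sP z : (z \in s) = (x z != z).
  apply/idP/idP => [zs|/eqP xz].
    by apply/eqP; have : [set` s] z by []; rewrite -sE.
  by have : [set z | x z <> z] z by []; rewrite sE.
have us : uniq (undup s) by exact: undup_uniq.
rewrite (drift_seq us); last first.
  by move=> z; rewrite mem_undup sP negbK => /eqP->.
rewrite sumrB -(big_map x predT w); apply/eqP; rewrite subr_eq0; apply/eqP.
apply: perm_big; apply: uniq_perm; rewrite ?map_inj_uniq //; first exact: sym_inj.
move=> z; rewrite mem_undup sP; apply/mapP/idP => [[v]|zx].
  by rewrite mem_undup sP => xv ->; rewrite (inj_eq (@sym_inj _ x)).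
exists (x^-1 z); last by rewrite symVK.
by rewrite mem_undup sP symVK -(inj_eq (@sym_inj _ x)) symVK.
Qed.

Lemma drift1 w : almost_invariant w 1 /\ drift w 1 = 0%R.
Proof. by apply: drift_finite; rewrite (_ : [set _ | _] = set0) //; apply/seteqP; split. Qed.

Lemma driftV w x : almost_invariant w x ->
  almost_invariant w x^-1 /\ drift w x^-1 = (- drift w x)%R.
Proof.
move=> wx; have wV : almost_invariant w x^-1.
  have := finite_image x wx; apply: sub_finite_set => z /= wz.
  by exists (x^-1 z); rewrite ?symVK // => /esym.
split=> //; have [_] := driftM wx wV; rewrite mulgV (drift1 w).2.
by move=> /esym/eqP; rewrite addrC addr_eq0 => /eqP.
Qed.

Lemma sum_mem (s q : seq T) : uniq s -> uniq q ->
  {subset s <= q} -> (\sum_(z <- q) ((z \in s) : nat)%:Z = (size s)%:Z)%R.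
Proof.
move=> us uq sq; rewrite -(big_morph Posz PoszD erefl) -big_mkcond /= sum1_count.
congr Posz; rewrite -size_filter; apply: perm_size; apply: uniq_perm => //.
  exact: filter_uniq.
by move=> z; rewrite mem_filter; apply: andb_idr; apply: sq.
Qed.

(** For [w] the indicator function of [A], the hypothesis says that [x] maps the
    disjoint union of [A] and [s] onto that of [A] and [r]. *)
Lemma drift_transfer w x (s r : seq T) :
  uniq s -> uniq r ->
  (forall z, w (x z) + ((x z \in r) : nat)%:Z = w z + ((z \in s) : nat)%:Z)%R ->
  almost_invariant w x /\ drift w x = ((size s)%:Z - (size r)%:Z)%R.
Proof.
move=> us ur wx; pose r' := map (x^-1)%g r.
have ur' : uniq r' by rewrite map_inj_uniq //; apply: sym_inj.
have r'E z : (x z \in r) = (z \in r').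
  by rewrite -(mem_map (@sym_inj _ x^-1)) symK.
have wE z : (w (x z) - w z = ((z \in s) : nat)%:Z - ((z \in r') : nat)%:Z)%R.
  by have := wx z; rewrite r'E; lia.
pose q := undup (s ++ r').
have wq z : z \notin q -> w (x z) = w z.
  rewrite mem_undup mem_cat negb_or => /andP[/negbTE zs /negbTE zr].
  by have := wE z; rewrite zs zr; lia.
split.
  apply: (@sub_finite_set _ _ [set` q]); last exact: finite_seq.
  by move=> z /= wz; apply: contrapT => /negP /wq.
rewrite (drift_seq (undup_uniq _) wq) (eq_bigr _ (fun z _ => wE z)) sumrB.
rewrite !sum_mem ?undup_uniq ?size_map // => z; rewrite mem_undup mem_cat => ->.
  by rewrite orbT.
by [].
Qed.

End Drift.

(** * Drifts are controlled by translations *)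

(** A rational relation exists by rank considerations; multiply it by all
    denominators. *)
Lemma int_dependent n (t : 'I_n.+1 -> 'rV[int]_n) :
  exists2 c : 'I_n.+1 -> int, exists i, c i != 0%R & (\sum_i t i *~ c i = 0)%R.
Proof.
pose A : 'M[rat]_(n.+1, n) := (\matrix_(i, j) (t i ord0 j)%:~R)%R.
have /rowV0Pn[v vA v0] : kermx A != 0%R.
  by rewrite kermx_eq0 /row_free neq_ltn (leq_ltn_trans (rank_leq_col A)).
have {}vA : (v *m A = 0)%R by apply/sub_kermxP.
pose d : int := (\prod_j denq (v ord0 j))%R.
have dE i : ((numq (v ord0 i) * \prod_(j | j != i) denq (v ord0 j))%:~R = d%:~R * v ord0 i :> rat)%R.
  by rewrite /d [in RHS](bigD1 i) //= !intrM numqE; ring.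
exists (fun i => numq (v ord0 i) * \prod_(j | j != i) denq (v ord0 j))%R.
  have /rV0Pn[i vi] := v0.
  exists i; rewrite mulf_neq0 ?numq_eq0 //.
  by apply/prodf_neq0 => j _; apply: denq_neq0.
apply/rowP => j; rewrite summxE mxE; apply/eqP; rewrite -(intr_eq0 rat) rmorph_sum /=.
have := congr1 (fun u : 'rV_n => u ord0 j) vA; rewrite !mxE => vAj.
apply/eqP; transitivity (d%:~R * \sum_i v ord0 i * A i j)%R; last by rewrite vAj mulr0.
rewrite mulr_sumr; apply: eq_bigr => i _.
rewrite -scaler_int intz mxE intrM dE [A i j]mxE; ring.
Qed.

Section Rank.
Variables (n r : nat) (w : 'I_r -> ray_space n -> int).

(** The pairs formed by the translation vector and the drifts of a permutation.
    They form a subgroup, and the translation vector determines the drifts, as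
    a permutation without translation is finitely supported and has no
    drift. *)
Definition realised (p : 'rV[int]_n * 'rV[int]_r) :=
  exists x, translation_vector x p.1 /\
    forall j, almost_invariant (w j) x /\ drift (w j) x = p.2 ord0 j.

Lemma realised0 : realised 0%R.
Proof.
exists 1; split; first exact: translation_vector1.
by move=> j; rewrite mxE; apply: drift1.
Qed.

Lemma realisedD p q : realised p -> realised q -> realised (p + q)%R.
Proof.
move=> [x [xt xd]] [y [yt yd]]; exists (x * y); split; first exact: translation_vectorM.
move=> j; rewrite mxE.
have [xi <-] := xd j; have [yi <-] := yd j.
exact: driftM.
Qed.

Lemma realisedN p : realised p -> realised (- p)%R.
Proof.
move=> [x [xt xd]]; exists x^-1; split; first exact: translation_vectorV.
by move=> j; have [xj e] := xd j; rewrite mxE -e; apply: driftV.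
Qed.

Lemma realisedMz p (c : int) : realised p -> realised (p *~ c)%R.
Proof.
move=> rp; have rpn m : realised (p *+ m)%R.
  by elim: m => [|m IH]; [exact: realised0 | rewrite mulrS; apply: realisedD].
by case: c => m; [exact: rpn | rewrite NegzE mulrNz; apply/realisedN/rpn].
Qed.

End Rank.

(** Otherwise the drift vectors of the [x i] would be linearly independent, as
    nonzero multiples of the unit vectors, whereas a combination of them with
    coefficients that kill the translation vectors is zero. *)
Lemma drift_rank n (w : 'I_n.+1 -> ray_space n -> int)
    (x : 'I_n.+1 -> sym (ray_space n)) :
  (forall i, houghton_perm (x i)) ->
  (forall i j, almost_invariant (w j) (x i)) ->
  (forall i j, i != j -> drift (w j) (x i) = 0%R) ->
  exists i, drift (w i) (x i) = 0%R.
Proof.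
move=> xH xw xw0; have /choice[t xt] i := houghton_translation (xH i).
have [c [i ci] ct] := int_dependent t; exists i.
pose p i := (t i, \row_j drift (w j) (x i))%R.
have : realised w (\sum_i p i *~ c i)%R.
  elim/big_ind: _ => [||k _]; [exact: realised0|exact: realisedD|].
  apply: realisedMz; exists (x k); split; first exact: xt.
  by move=> j; rewrite mxE; split.
move=> [y []]; rewrite [(\sum_i _)%R]surjective_pairing !raddf_sum /=.
rewrite (eq_bigr (fun i => t i *~ c i)%R); last by move=> k _; rewrite raddfMz.
rewrite ct => /translation_vector0_finite yfin /(_ i)[_].
rewrite (drift_finite (w i) yfin).2 summxE (bigD1 i) //= big1 => [|k ki].
  rewrite raddfMz /= -scaler_int intz !mxE addr0 => /esym/eqP.
  by rewrite mulf_eq0 (negbTE ci) => /eqP.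
by rewrite raddfMz /= -scaler_int intz !mxE xw0 // mulr0.
Qed.

(** * Points of exact period k *)

Section Periods.
Variable T : choiceType.
Implicit Types (g h x : sym T) (z : T) (s : seq T).

Definition exact_period k g z :=
  iter k g z = z /\ forall j, (0 < j < k)%N -> iter j g z <> z.

Lemma exact_periodJ k g x z : exact_period k (g ^ x) (x z) <-> exact_period k g z.
Proof.
have itJ j : iter j (g ^ x) (x z) = x (iter j g z).
  by elim: j => // j IH; rewrite !iterS IH symJE.
split=> -[pk pj]; split.
- by apply: (@sym_inj _ x); rewrite -itJ.
- by move=> j /pj; rewrite itJ => ne e; apply: ne; rewrite e.
- by rewrite itJ pk.
- by move=> j /pj ne; rewrite itJ => /sym_inj.
Qed.

Lemma iter_next s z j : uniq s -> z \in s -> (j <= size s)%N ->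
  (iter j (next s) z == z) = (j == 0%N) || (j == size s).
Proof.
move=> us zs; have [i s' sE] := rot_to zs.
have -> : iter j (next s) z = iter j (next (z :: s')) z.
  by apply: eq_iter => v; rewrite -sE next_rot.
have u' : uniq (z :: s') by rewrite -sE rot_uniq.
have -> : size s = (size s').+1 by rewrite -(size_rot i s) sE.
have it k : (k <= size s')%N -> iter k (next (z :: s')) z = nth z (z :: s') k.
  elim: k => // k IH ks; rewrite iterS IH ?(ltnW ks) //.
  rewrite next_nth mem_nth ?ltnS ?(ltnW ks) // index_uniq //.
  by rewrite ltnS ltnW.
rewrite leq_eqVlt => /predU1P[->|/[dup] js]; last rewrite ltnS => js'.
  rewrite iterS it // next_nth mem_nth // index_uniq //=.
  by rewrite nth_default // !eqxx.
rewrite it // (ltn_eqF js) orbF -[X in _ == X]/(nth z (z :: s') 0).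
by rewrite nth_uniq.
Qed.

(** The cycle [s] is made of fixed points of [g], so it is disjoint from all
    nontrivial cycles of [g]. *)
Lemma exact_period_cycle g s : uniq s -> (1 < size s)%N ->
  (forall z, z \in s -> g z = z) -> forall k z, (1 < k)%N ->
  exact_period k (g * cycle_perm s) z <->
  exact_period k g z \/ (k = size s /\ z \in s).
Proof.
move=> us s1 gs k z k1.
have [zs|zs] := boolP (z \in s).
  have it j : iter j (g * cycle_perm s) z = iter j (next s) z.
    have: iter j (next s) z \in s by elim: j => // j IH; rewrite iterS mem_next.
    elim: j => // j IH; rewrite !iterS mem_next => js.
    by rewrite IH // symME gs // cycle_permE.
  split=> [[pk pj]|[[_ /(_ 1%N)]|[-> _]]].
  - right; split=> //; apply/eqP; case: (ltngtP k (size s)) => // ks.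
      move/eqP: pk; rewrite it iter_next ?(ltnW ks) //.
      by rewrite (ltn_eqF ks) orbF => /eqP k0; rewrite k0 in k1.
    have /pj : (0 < size s < k)%N by rewrite ks (ltn_trans _ s1).
    by case; apply/eqP; rewrite it iter_next // eqxx orbT.
  - by rewrite k1 => /(_ isT); case; apply: gs.
  - split; first by apply/eqP; rewrite it iter_next // eqxx orbT.
    move=> j /andP[j0 js] /eqP; rewrite it iter_next ?(ltnW js) //.
    by rewrite (ltn_eqF js) orbF => /eqP e; rewrite e in j0.
have it j : iter j (g * cycle_perm s) z = iter j g z.
  have : iter j g z \notin s.
    elim: j => // j; apply: contra => js; move: (js); rewrite iterS.
    by move=> /gs /sym_inj <-.
  elim: j => // j IH; rewrite !iterS => js.
  have js' : iter j g z \notin s.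
    by apply: contra js => jin; rewrite gs.
  by rewrite IH // symME cycle_permE // next_nth ifN.
split=> [[pk pj]|[[pk pj]|[_ //]]].
  by left; split=> [|j /pj]; rewrite -it.
by split=> [|j /pj]; rewrite it.
Qed.

Lemma alternating_odd_cycle s : uniq s -> odd (size s) -> alternating (cycle_perm s).
Proof.
move: {2}(size s) (leqnn (size s)) => m; elim: m s => [|m IH] [|x [|y [|z s]]] //=.
  move=> _ _ _; rewrite (_ : cycle_perm _ = 1); first by left.
  by apply: sym_ext => v; rewrite cycle_permE //=; case: eqP.
rewrite ltnS negbK => sm u os.
have u3 : uniq [:: x; y; z].
  by have := (u : uniq ([:: x; y; z] ++ s)); rewrite cat_uniq => /andP[].
have [xy xz yz] := uniq3P _ _ _ u3.
have us : uniq (x :: s).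
  by move: u; rewrite /= !inE !negb_or => /and4P[/and3P[_ _ ->] _ _ ->].
(* The cycle through x, y, z and s closes up after x, y, z and then runs
   through s. *)
have -> : cycle_perm [:: x, y, z & s] = cycle3 x y z * cycle_perm (x :: s).
  apply: sym_ext => v; rewrite symME cycle3E // !cycle_permE //.
  have yzs : (y \notin s) /\ (z \notin s).
    by move: u; rewrite /= !inE !negb_or => /and4P[_ /andP[_ ->] ->].
  have fixed a : a != x -> a \notin s -> next (x :: s) a = a.
    by move=> ax as'; rewrite next_nth ifN // inE negb_or ax.
  case: (v =P x) => [->|/eqP vx].
    by rewrite fixed /= ?eqxx ?yzs.1 //; apply/eqP/nesym.
  case: (v =P y) => [->|/eqP vy].
    by rewrite fixed /= ?eqxx ?[y == x]eq_sym ?yzs.2 ?(introF eqP xy) //; apply/eqP/nesym.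
  case: (v =P z) => [->|/eqP vz].
    rewrite /= [z == x]eq_sym [z == y]eq_sym (introF eqP xz) (introF eqP yz).
    by case: (s) => [|a r] /=; rewrite !eqxx.
  rewrite /= (negbTE vx) (negbTE vy).
  by case: (s) => [|a r] /=; rewrite ?(negbTE vx) ?(negbTE vz).
apply: alternating_mul; first exact: alternating_cycle3.
by apply: IH => //=; lia.
Qed.

End Periods.

(** * Creating fixed points and cycles *)

Section Creation.
Variable T : choiceType.
Hypothesis Tinf : infinite_set [set: T].
Implicit Types (g c : sym T) (s : seq T).

(** For a point [p] that [h] moves, a 3-cycle that maps [h p] back to [p] makes
    [p] a fixed point.  The third point [q] of the 3-cycle is chosen so as to
    create or destroy no other fixed point. *)
Lemma many_fixed_points g s : uniq s -> (forall z, g z = z <-> z \in s) ->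
  forall m, exists c r, [/\ alternating c, uniq r, size r = (size s + m)%N &
    forall z, (g * c) z = z <-> z \in r].
Proof.
move=> us gs; elim=> [|m [c [r [ac ur rsz cr]]]].
  by exists 1, s; rewrite addn0 mulg1; split=> //; left.
set h := g * c in cr; have [p _ pr] := infinite_set_fresh r Tinf.
have hp : h p <> p by move=> /cr; apply/negP.
have [q _] := infinite_set_fresh (r ++ [:: p; h p; h (h p); (h^-1)%g p]) Tinf.
rewrite mem_cat negb_or => /andP[qr]; rewrite !inE !negb_or.
move=> /and4P[/eqP qp /eqP qhp /eqP qhhp /eqP qhVp].
have hq : h q <> q by move=> /cr; apply/negP.
have u : uniq [:: h p; p; q] by apply/uniq3P; split; congruence.
exists (c * cycle3 (h p) p q), (p :: r); split.
- exact: alternatingM.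
- by rewrite /= pr.
- by rewrite /= rsz addnS.
move=> z; rewrite mulgA -/h symME inE; split; last first.
  move=> /predU1P[->|/cr hz]; first by rewrite cycle3E // eqxx.
  have zhp : z <> h p by move=> e; move: hz; rewrite e => /sym_inj.
  have zp : z <> p by congruence.
  have zq : z <> q by congruence.
  by rewrite hz cycle3E //; eq_cases.
rewrite cycle3E //; case: eqP => [/sym_inj -> _|hzhp]; first by rewrite eqxx.
case: eqP => [hzp qz|hzp]; first by case: qhVp; rewrite -hzp symK.
case: eqP => [hzq hpz|hzq /cr ->]; last by rewrite orbT.
by case: qhhp; rewrite hpz.
Qed.

(** The new cycles are taken inside the fixed points of [g]; lengths are odd to
    keep the permutations alternating. *)
Lemma many_cycles g k : infinite_set [set z | g z = z] -> (1 < k)%N -> odd k ->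
  forall m, exists c s, [/\ alternating c, uniq s, size s = (m * k)%N,
    (forall z, z \in s -> g z = z) /\
    (forall z, z \notin s -> g z = z -> (g * c) z = z) &
    forall j z, (1 < j)%N ->
      exact_period j (g * c) z <-> exact_period j g z \/ (j = k /\ z \in s)].
Proof.
move=> ginf k1 ok; elim=> [|m [c [s [ac us ssz [sg sfix] sper]]]].
  exists 1, [::]; rewrite mulg1; split=> //; first by left.
  by move=> j z _; split=> [|[|[]]] //; left.
have [r [rk ur rP]] := infinite_set_fresh_seq s k ginf.
have rfix z : z \in r -> (g * c) z = z by move=> /rP[gz zs]; apply: sfix.
have r1 : (1 < size r)%N by rewrite rk.
exists (c * cycle_perm r), (r ++ s); split.
- by apply: alternating_mul => //; apply: alternating_odd_cycle; rewrite ?rk.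
- rewrite cat_uniq ur us andbT; apply/hasPn => z zs.
  by apply: contraL zs => /rP[].
- by rewrite size_cat rk ssz mulSn.
- split=> z; rewrite mem_cat; first by case/orP=> [/rP[]|/sg].
  rewrite negb_or => /andP[zr zs] gz.
  by rewrite mulgA symME sfix // cycle_permE // next_nth ifN.
move=> j z j1; rewrite mulgA (exact_period_cycle ur r1 rfix) // sper // rk mem_cat.
split=> [[[|[-> ->]]|[-> ->]]|[|[->]]]; first by left.
- by right; rewrite orbT.
- by right.
- by left; left.
by move=> /orP[zr|zs]; [right | left; right].
Qed.

End Creation.

(** * A coset of the alternating group meets infinitely many Houghton classes *)

Lemma infinite_ray_space n : (0 < n)%N -> infinite_set [set: ray_space n].
Proof.
move=> n0 fin; apply: infinite_nat.
apply: (@sub_finite_set _ _ (snd @` [set: ray_space n])); last exact: finite_image.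
by move=> m _; exists (Ordinal n0, m).
Qed.

(** If the fixed points of [g] are finite in number, their number distinguishes
    conjugacy classes.  Otherwise, apply the hypothesis for each of the [n + 1]
    lengths [k i = 3, 5, ...] to permutations that create [k i]-cycles out of
    fixed points; the conjugator then has a nonzero drift on the points of
    period [k i] of [g], and no drift for the other lengths, against
    [drift_rank]. *)
Lemma coset_not_fused n (g : sym (ray_space n)) : (0 < n)%N ->
  ~ (forall a : nat -> sym (ray_space n), (forall j, alternating (a j)) ->
      exists i j x, [/\ i <> j, houghton_perm x & (g * a i) ^ x = g * a j]).
Proof.
move=> n0; have Tinf := infinite_ray_space n0; move=> fused.
have [/finite_seqP[s0 s0E]|ginf] := pselect (finite_set [set z | g z = z]).
  have gs z : g z = z <-> z \in undup s0.
    rewrite mem_undup; split=> [gz|zs].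
      by have : [set z | g z = z] z by []; rewrite s0E.
    by have : [set` s0] z by []; rewrite -s0E.
  have /choice[a aP] := many_fixed_points Tinf (undup_uniq s0) gs.
  have [i [j [x [ij _ e]]]] := fused a (fun j => let: ex_intro _ H := aP j in
    let: And4 H _ _ _ := H in H).
  have [r [_ ur rsz rP]] := aP i; have [s [_ us ssz sP]] := aP j.
  apply: ij; apply: (@addnI (size (undup s0))); rewrite -rsz -ssz.
  rewrite -(size_map x r); apply: perm_size; apply: uniq_perm => //.
    by rewrite map_inj_uniq //; apply: sym_inj.
  move=> z; apply/idP/idP => [/mapP[v /rP gv ->]|/sP gz].
    by apply/sP; rewrite -e symJE gv.
  apply/mapP; exists ((x^-1)%g z); last by rewrite symVK.
  by apply/rP; apply: (@sym_inj _ x); rewrite -[LHS]symJE !symVK e.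
pose k i := (2 * i + 3)%N.
have k1 i : (1 < k i)%N by rewrite /k; lia.
have kodd i : odd (k i) by rewrite /k; lia.
pose w (j : 'I_n.+1) z : int := (`[< exact_period (k j) g z >] : nat).
have /choice[x xP] (i : 'I_n.+1) : exists x, [/\ houghton_perm x,
    forall j, almost_invariant (w j) x &
    forall j, drift (w j) x = 0%R <-> i <> j].
  have /choice[a aP] := many_cycles ginf (k1 i) (kodd i).
  have [m [m' [x [mm xH e]]]] := fused a (fun j => let: ex_intro _ H := aP j in
    let: And5 H _ _ _ _ := H in H).
  have [s [_ us ssz [sg _] sP]] := aP m; have [r [_ ur rsz [rg _] rP]] := aP m'.
  have notper j z : g z = z -> ~ exact_period (k j) g z.
    by move=> gz [_ /(_ 1%N)]; rewrite k1 => /(_ isT).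
  (* The points of the new cycles, according to the length that is counted. *)
  pose sj (j : 'I_n.+1) := if i == j then s else [::].
  pose rj (j : 'I_n.+1) := if i == j then r else [::].
  have kE (j : 'I_n.+1) : (k j == k i) = (i == j).
    by apply/eqP/eqP => [kij|-> //]; apply/val_inj => /=; rewrite /k in kij; lia.
  have count h q (j : 'I_n.+1) z : (forall v, v \in q -> g v = v) ->
      (forall j v, (1 < j)%N ->
        exact_period j h v <-> exact_period j g v \/ (j = k i /\ v \in q)) ->
      (`[< exact_period (k j) h z >] =
       `[< exact_period (k j) g z >] + (z \in if i == j then q else [::]) :> nat)%N.
    move=> qg /(_ (k j) z (k1 j)) hE; rewrite -(kE j).
    have -> : `[< exact_period (k j) h z >] =
        `[< exact_period (k j) g z >] || (k j == k i) && (z \in q).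
      by apply/asboolP/orP => [/hE[gz|[-> zq]]|[/asboolP gz|/andP[/eqP kk zq]]];
        [left; apply/asboolP | right; rewrite eqxx | apply/hE; left | apply/hE; right].
    case: eqP => [_|]; rewrite ?andbF ?orbF ?addn0 //=.
    have [zq|] := boolP (z \in q); last by rewrite orbF addn0.
    by rewrite (asboolF (notper j z (qg _ zq))).
  have xw j : almost_invariant (w j) x /\ drift (w j) x = ((size (sj j))%:Z - (size (rj j))%:Z)%R.
    apply: drift_transfer => [||z]; rewrite /sj /rj; do ?[by case: ifP].
    rewrite /w -!PoszD -(count _ _ j _ sg sP) -(count _ _ j _ rg rP) -e; congr (Posz (nat_of_bool _)).
    exact/asbool_equiv_eq/exact_periodJ.
  exists x; split=> // j; first by have [] := xw j.
  have [_ ->] := xw j; rewrite /sj /rj; case: eqP => [ij|//].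
  split=> // /eqP; rewrite ssz rsz subr_eq0 eqz_nat eqn_pmul2r ?(ltnW (k1 i)) //.
  by move=> /eqP /mm.
have [i d0] : exists i, drift (w i) (x i) = 0%R.
  apply: drift_rank => [i|i j|i j /eqP ij]; first by have [] := xP i.
    by have [_ /(_ j)] := xP i.
  by have [_ _ /(_ j)[_]] := xP i; apply.
by have [_ _ /(_ i)[/(_ d0)]] := xP i.
Qed.

(** * Twisted classes and cosets *)

Lemma infinite_pigeonhole (A : Type) (D : set A) (f : nat -> A) :
  finite_set D -> (forall j, D (f j)) -> exists i j, i <> j /\ f i = f j.
Proof.
move=> Dfin fD; apply: contrapT => no; apply: infinite_nat.
apply: (@sub_finite_set _ _ (f @^-1` D)); first by move=> j _; apply: fD.
apply: finite_preimage => // i j _ _ fij.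
by apply: contrapT => ij; apply: no; exists i, j.
Qed.

Section Subgroups.
Variable G : groupType.

Definition left_coset (N : groupClosed G) (x : G) : set G :=
  [set x * y | y in [set` N]].

Lemma left_coset_eq (N : groupClosed G) x y :
  left_coset N x = left_coset N y -> x^-1 * y \in N.
Proof.
move=> xy; have : left_coset N y y by exists 1; rewrite ?mulg1 //= gpred1.
by rewrite -xy => -[z zN <-]; rewrite mulKg.
Qed.

(** Two sequences at once, in order to apply it to a sequence and to its image
    under an automorphism. *)
Lemma finite_index_pigeonhole (N : groupClosed G) (u v : nat -> G) :
  finite_index N ->
  exists i j, [/\ i <> j, (u i)^-1 * u j \in N & (v i)^-1 * v j \in N].
Proof.
move=> Nfin; pose f j := (left_coset N (u j), left_coset N (v j)).
have [i [j [ij [uij vij]]]] : exists i j, i <> j /\ f i = f j.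
  apply: infinite_pigeonhole (finite_setX Nfin Nfin) _ => j.
  by split; [exists (u j) | exists (v j)].
by exists i, j; split=> //; apply: left_coset_eq.
Qed.

Variable phi : {multiplicative G -> G}.

Lemma multiplicative1 : phi 1 = 1.
Proof. by apply: (mulIg (phi 1)); rewrite -gmulfM !mul1g. Qed.

Lemma multiplicativeV x : phi x^-1 = (phi x)^-1.
Proof. by apply: (mulIg (phi x)); rewrite -gmulfM !mulVg multiplicative1. Qed.

(** Each [u j] is twisted conjugate, by some [x j], to the representative of its
    class.  If [u i] and [u j] have the same representative, then [x i ^-1 * x j]
    conjugates one to the other; if moreover [x i] and [x j] lie in the same
    coset of [N], and likewise for their images under [phi], it has the
    required form. *)
Lemma twisted_pigeonhole (N : groupClosed G) (u : nat -> G) :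
  finite_index N -> finite_set (twisted_classes phi) ->
  exists i j x, [/\ i <> j, x \in N, phi x \in N & phi x^-1 * u i * x = u j].
Proof.
move=> Nfin Cfin.
have /choice[r rP] (C : set G) : exists a, forall j,
    C = twisted_class phi (u j) -> twisted_conjugate phi a (u j).
  have [[i iC]|no] := pselect (exists i, C = twisted_class phi (u i)); last first.
    by exists 1 => j jC; case: no; exists j.
  exists (u i) => j; rewrite iC => e.
  have : twisted_class phi (u j) (u j).
    by exists 1; rewrite invg1 multiplicative1 mul1g mulg1.
  by rewrite -e.
have /choice[x xP] j : twisted_conjugate phi (r (twisted_class phi (u j))) (u j).
  exact: rP.
pose f j := (twisted_class phi (u j), (left_coset N (x j), left_coset N (phi (x j)))).
have [i [j [ij]]] : exists i j, i <> j /\ f i = f j.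
  pose cosets := [set left_coset N y | y in [set: G]].
  apply: (@infinite_pigeonhole _ (twisted_classes phi `*` (cosets `*` cosets))).
    by apply: finite_setX => //; apply: finite_setX.
  by move=> j; split; [exists (u j) | split; [exists (x j) | exists (phi (x j))]].
move=> [cij /left_coset_eq xij /left_coset_eq yij].
exists i, j, ((x i)^-1 * x j); split=> //; first by rewrite gmulfM multiplicativeV.
rewrite -(xP i) -[RHS](xP j) cij invgM invgK gmulfM !mulgA mulgK.
by rewrite -(mulgA (phi _)) -gmulfM mulgV multiplicative1 mulg1.
Qed.

End Subgroups.

Section Stabilised.
Variables (G : groupType) (N : groupClosed G) (phi : {multiplicative G -> G}).

Definition stays_pred (x : G) := (x \in N) && (phi x \in N).

Fact stays_closed : group_closed stays_pred.
Proof.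
split; first by rewrite unfold_in /stays_pred multiplicative1 !gpred1.
move=> x y /andP[xN pxN] /andP[yN pyN].
by rewrite unfold_in /stays_pred gmulfM multiplicativeV !gpredF.
Qed.

(** The group [N] intersected with its preimage under [phi], as a type. *)
Record stays := Stays { stays_val :> G; stays_valP : stays_pred stays_val }.
HB.instance Definition _ := [isSub for stays_val].
HB.instance Definition _ := [Choice of stays by <:].
HB.instance Definition _ := SubChoice_isSubGroup.Build G stays_pred stays stays_closed.

End Stabilised.

(** * Groups commensurable to a Houghton group *)

Lemma stays_valM (G : groupType) (N : groupClosed G) (phi : {multiplicative G -> G}) :
  {morph @stays_val G N phi : x y / x * y}.
Proof. by []. Qed.

Section PartialMorphism.
Variables (G H : groupType) (N : groupClosed G) (f : G -> H).
Hypothesis fM : {in N &, {morph f : x y / x * y}}.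

Lemma morph_in1 : f 1 = 1.
Proof. by apply: (mulIg (f 1)); rewrite -fM ?gpred1 // !mul1g. Qed.

Lemma morph_inV y : y \in N -> f y^-1 = (f y)^-1.
Proof.
by move=> yN; apply: (mulIg (f y)); rewrite -fM ?gpredV // !mulVg morph_in1.
Qed.

End PartialMorphism.

Section Commensurable.
Variables (n : nat) (G : groupType) (NG : groupClosed G).
Variables (NH : groupClosed (houghton n)) (f : G -> houghton n).
Hypotheses (n_gt0 : (0 < n)%N).
Hypotheses (NG_normal : normal_subgroup NG) (NG_fin : finite_index NG).
Hypotheses (NH_normal : normal_subgroup NH) (NH_fin : finite_index NH).
Hypotheses (f_bij : set_bij [set` NG] [set` NH] f).
Hypotheses (fM : {in NG &, {morph f : x y / x * y}}).

Let f_inj x y : x \in NG -> y \in NG -> f x = f y -> x = y.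
Proof. by move=> xN yN; have [_ + _] := f_bij; apply; rewrite inE. Qed.

Let fV y : y \in NG -> f y^-1 = (f y)^-1.
Proof. exact: morph_inV. Qed.

Let fJ x y : x \in NG -> y \in NG -> f (x ^ y) = f x ^ f y.
Proof. by move=> xN yN; rewrite /conjg !fM ?gpredM ?gpredV // fV. Qed.

(** A first use of [cycle3_in_normal], with [NH] normal in [H_n].  The second
    one, for the action of [stays], relies on it: there the subgroup is only
    normalised by [NG]. *)
Lemma cycle3_in_commensurable (c : sym (ray_space n)) :
  is_cycle3 c -> exists2 y, y \in NG & houghton_val (f y) = c.
Proof.
suff cNH : is_cycle3 c -> exists2 h, h \in NH & houghton_val h = c.
  move=> /cNH[h hN <-]; have [_ _ /(_ h hN)[y yN <-]] := f_bij.
  by exists y.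
have lift d : is_cycle3 d -> exists h : houghton n, houghton_val h = d.
  by move=> /cycle3_houghton/asboolP dH; exists (Houghton dH).
move: c; apply: cycle3_in_normal (infinite_ray_space n_gt0) _ _ => [_ _ /lift[d <-] [h hN <-]|u u3].
  by exists (h ^ d); [exact: NH_normal | by []].
have /choice[h hE] j := lift _ (u3 j).
have [i [j [ij hN _]]] := finite_index_pigeonhole h h NH_fin.
by exists i, j; split=> //; exists ((h i)^-1 * h j); rewrite // -!hE.
Qed.

Variable phi : {multiplicative G -> G}.

(** The two cases of interest are [pi] the identity and [pi = phi]. *)
Definition stays_action (pi : G -> G) (m : stays NG phi) : sym (ray_space n) :=
  houghton_val (f (pi (stays_val m))).

Lemma stays_action_embedding (pi : {multiplicative G -> G}) : bijective pi ->
  (forall m : stays NG phi, pi (stays_val m) \in NG) ->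
  alt_embedding (stays_action pi).
Proof.
move=> [pi' piK piK'] piN; split.
- by move=> p q; rewrite /stays_action stays_valM gmulfM fM.
- by move=> p q /val_inj /f_inj e; apply/val_inj/(can_inj piK)/e.
- apply: cycle3_in_normal (infinite_ray_space n_gt0) _ _.
    move=> _ c /cycle3_in_commensurable[y yN <-] [m <-].
    have /andP[mN pmN] := stays_valP m.
    have st : stays_pred NG phi (stays_val m ^ pi' y).
      by rewrite /stays_pred /conjg !gmulfM multiplicativeV !NG_normal.
    exists (Stays st); rewrite /stays_action /= /conjg !gmulfM multiplicativeV piK'.
    by rewrite -/(_ ^ _) fJ.
  move=> u u3; have /choice[y yE] j : exists y, y \in NG /\ houghton_val (f y) = u j.
    by have [y] := cycle3_in_commensurable (u3 j); exists y.
  have [i [j [ij xN pN]]] :=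
    finite_index_pigeonhole (pi' \o y) (phi \o pi' \o y) NG_fin.
  have st : stays_pred NG phi ((pi' (y i))^-1 * pi' (y j)).
    by rewrite /stays_pred xN gmulfM multiplicativeV.
  exists i, j; split=> //; exists (Stays st).
  have [yi <-] := yE i; have [yj <-] := yE j.
  by rewrite /stays_action /= gmulfM multiplicativeV !piK' fM ?gpredV // fV.
- move=> p p3; apply: houghton_torsion_finite; first exact/asboolP/houghton_valP.
  have aM (q r : stays NG phi) : stays_action pi (q * r) = stays_action pi q * stays_action pi r.
    by rewrite /stays_action stays_valM gmulfM fM.
  have a1 : stays_action pi 1 = 1.
    by apply: (mulIg (stays_action pi 1)); rewrite -aM !mul1g.
  by rewrite expgS expg2 -!aM -expg2 -expgS p3.
Qed.

End Commensurable.

Theorem theorem4p6 (n : nat) (hn : (0 < n)%N) (G : groupType) :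
  commensurable G (houghton n) -> R_infty G.
Proof.
move=> [NG [NH [NGn NGf NHn NHf [f [fbij fM]]]]] phi phi_bij Cfin.
have aP : alt_embedding (stays_action f (phi := phi) (NG := NG) idfun).
  apply: (@stays_action_embedding _ _ _ _ _ hn NGn NGf NHn NHf fbij fM phi idfun) => [|m].
    by exists id.
  by have /andP[] := stays_valP m.
have bP : alt_embedding (stays_action f (phi := phi) (NG := NG) phi).
  apply: (@stays_action_embedding _ _ _ _ _ hn NGn NGf NHn NHf fbij fM phi phi) => // m.
  by have /andP[] := stays_valP m.
have [s sE] := embeddings_conjugate (infinite_ray_space hn) aP bP.
apply: (@coset_not_fused n s hn) => c calt.
have /choice[p pE] j := alt_emb_alternating aP (calt j).
have [i [j [x [ij xN pxN xE]]]] := twisted_pigeonhole (fun j => stays_val (p j)) NGf Cfin.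
have st : stays_pred NG phi x by rewrite /stays_pred xN.
exists i, j, (stays_action f idfun (Stays st)); split=> //.
  exact/asboolP/houghton_valP.
have pN k : stays_val (p k) \in NG by have /andP[] := stays_valP (p k).
have : (stays_action f (phi := phi) phi (Stays st))^-1 * c i * stays_action f idfun (Stays st) = c j.
  rewrite -!pE /stays_action /= -xE multiplicativeV.
  by rewrite !fM ?gpredM ?gpredV // (morph_inV fM).
by rewrite sE => <-; rewrite /conjg !invgM invgK !mulgA mulgV mul1g.
Qed.
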